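(* Let $t$ be any finite rooted planar tree with at least one edge, let $q\ge1$ be an integer, and let $a$ be an integer coprime to $q$. Then there are infinitely many positive integers $n$ with $n\equiv a\pmod q$ and $t(n)=t$.
   Context: Every integer $n\ge 1$ is assigned a finite rooted planar tree $t(n)$: $t(1)$ is the single-vertex tree; if $n=p_1^{a_1}\cdots p_s^{a_s}$ with primes $p_1<\dots<p_s$ and $a_i\ge1$, then $t(n)$ consists of a root with $s$ edges to children, ordered left to right, the $i$-th edge leading to a copy of $t(a_i)$ rooted at that child. Every finite rooted planar tree arises as $t(n)$ for some $n$. *)

(* Defs.v *)
From mathcomp Require Import all_boot all_order all_algebra.
From mathcomp Require Import classical_sets cardinality.

Set Implicit Arguments.
Unset Strict Implicit.
Unset Printing Implicit Defensive.

(* The list gives the subtrees at the children of the root, left to right. *)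
Inductive planar_tree : Type := Node of seq planar_tree.

Fixpoint num_edges (t : planar_tree) : nat :=
  let: Node ts := t in sumn [seq (num_edges u).+1 | u <- ts].

(* The first argument is fuel: since logn p n < n for p in primes n, fuel n
   suffices, as tree_ofE below shows. *)
Fixpoint tree_of_rec (k n : nat) : planar_tree :=
  if k is k'.+1
  then Node [seq tree_of_rec k' (logn p n) | p <- primes n]
  else Node [::].

(* t(n); primes n is in increasing order. The value at 0 is a junk value. *)
Definition tree_of (n : nat) : planar_tree := tree_of_rec n n.

Lemma tree_of_rec_fuel (k n : nat) : n <= k -> tree_of_rec k n = tree_of n.
Proof.
suff fuel k1 k2 m : m <= k1 -> m <= k2 -> tree_of_rec k1 m = tree_of_rec k2 m.
  by move=> le_nk; apply: fuel.
elim: k1 k2 m => [|k1 IH] [|k2] m //=.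
- by rewrite leqn0 => /eqP ->.
- by move=> _; rewrite leqn0 => /eqP ->.
move=> le1 le2; congr Node; apply/eq_in_map => p.
rewrite mem_primes => /and3P[_ m_gt0 _].
have lt_log := ltn_logl p m_gt0.
by apply: IH; rewrite -ltnS; apply: leq_trans lt_log _.
Qed.

Lemma tree_of1 : tree_of 1 = Node [::].
Proof. by []. Qed.

Lemma tree_ofE (n : nat) :
  tree_of n = Node [seq tree_of (logn p n) | p <- primes n].
Proof.
case: n => [|n] //; rewrite {1}/tree_of.
rewrite [tree_of_rec _ _]/=; congr Node; apply/eq_in_map => p _.
by apply: tree_of_rec_fuel; rewrite -ltnS ltn_logl.
Qed.

(* Main.v *)
Require Import Defs.
From mathcomp Require Import all_boot all_order all_algebra.
From mathcomp Require Import all_fingroup all_solvable all_field all_character.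
From mathcomp Require Import boolp classical_sets cardinality.
From mathcomp Require Import reals sequences exp complex Rstruct.
From mathcomp Require Import ring lra zify.

(** The tree with one edge is t(p) for p prime, so the statement contains
    Dirichlet's theorem on primes in arithmetic progressions; conversely
    Dirichlet's theorem suffices. By induction on the tree, each subtree at a
    child of the root is t(e) for some e = 1 modulo totient q; taking increasing
    primes p_1 = a and p_2, ..., p_s = 1 modulo q with these exponents gives
    p_1^e_1 ... p_s^e_s = a modulo q.

    Dirichlet's theorem is proved by finite sums only, following Mertens,
    Shapiro and Monsky. For a nonprincipal character chi, let T(N) be the sum of
    chi(n) Lambda(n) / n over n <= N, and L the sum of the series chi(n) / n.
    Möbius inversion gives T(N) = O(1) if L <> 0 and T(N) = - ln N + O(1) if
    L = 0. Summing over all characters, L = 0 for at most one of them, hence not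
    for a non-real one and its conjugate; a real character with L = 0 would make
    the Lambert series of chi bounded near 1, although its coefficients
    \sum_(d | n) chi(d) are nonnegative and at least 1 at squares. Hence all T(N)
    are bounded, and since the principal character contributes ln N + O(1),
    orthogonality yields infinitely many primes in each class. *)

Set Implicit Arguments.
Unset Strict Implicit.
Unset Printing Implicit Defensive.

Import Order.TTheory GRing.Theory Num.Theory.

Local Open Scope ring_scope.

(** * Möbius and von Mangoldt functions *)

(** Both sides run over the pairs with [d * m <= N], on the right grouped by their product. Going
    from [N] to [N.+1], the quotient [N %/ d] grows exactly when [d] divides [N.+1]. *)
Lemma sum_divisors_exchange (V : nmodType) (g : nat -> nat -> V) N :
  \sum_(1 <= d < N.+1) \sum_(1 <= m < (N %/ d).+1) g d m =
  \sum_(1 <= n < N.+1) \sum_(1 <= d < n.+1 | (d %| n)%N) g d (n %/ d)%N.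
Proof.
elim: N => [|N IH]; first by rewrite !big_geq.
rewrite [RHS]big_nat_recr //= -IH [in RHS](big_mkcond (dvdn^~ _)) /=.
have -> : \sum_(1 <= d < N.+1) \sum_(1 <= m < (N %/ d).+1) g d m =
          \sum_(1 <= d < N.+2) \sum_(1 <= m < (N %/ d).+1) g d m.
  by rewrite [RHS]big_nat_recr //= divn_small // [X in _ + X]big_geq // addr0.
rewrite -big_split /=; apply: eq_big_nat => d /andP[d_gt0 _].
rewrite divnS //; case: (d %| N.+1)%N => /=; last by rewrite addr0.
by rewrite add1n big_nat_recr.
Qed.

(** Both sides run over the pairs with [d * e %| n], a symmetric condition. *)
Lemma sum_divisors_swap (V : nmodType) (g : nat -> nat -> V) n : (0 < n)%N ->
  \sum_(1 <= d < n.+1 | (d %| n)%N) \sum_(1 <= e < (n %/ d).+1 | (e %| n %/ d)%N)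
     g d e =
  \sum_(1 <= e < n.+1 | (e %| n)%N) \sum_(1 <= d < (n %/ e).+1 | (d %| n %/ e)%N)
     g d e.
Proof.
move=> n_gt0.
have dvd_quo d e : (0 < d)%N ->
    ((d %| n) && (e %| n %/ d) = (d * e %| n))%N.
  move=> d_gt0; case: (boolP (d %| n)%N) => [dn|ndn] /=.
    by rewrite dvdn_divRL // mulnC.
  by apply/esym/negbTE; apply: contra ndn => /(dvdn_trans (dvdn_mulr e (dvdnn d))).
have expand (h : nat -> nat -> V) :
    \sum_(1 <= d < n.+1 | (d %| n)%N)
      \sum_(1 <= e < (n %/ d).+1 | (e %| n %/ d)%N) h d e =
    \sum_(1 <= d < n.+1) \sum_(1 <= e < n.+1 | (d * e %| n)%N) h d e.
  rewrite big_mkcond; apply: eq_big_nat => d /andP[d_gt0 le_dn].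
  case: ifP => dn; last first.
    by rewrite big_pred0 // => e; rewrite -dvd_quo // dn.
  rewrite (big_nat_widen _ _ n.+1); last by rewrite ltnS leq_div.
  apply: eq_bigl => e; rewrite -dvd_quo // dn /= ltnS.
  case: (boolP (e %| n %/ d)%N) => //= en; apply: dvdn_leq => //.
  by rewrite divn_gt0 // dvdn_leq.
rewrite expand (expand (fun e d => g d e)).
rewrite (exchange_big_dep_nat xpredT) //=.
by apply: eq_big_nat => e _; apply: eq_bigl => d; rewrite mulnC.
Qed.

Definition mobius (n : nat) : int :=
  if all (fun p => logn p n == 1%N) (primes n) then (-1) ^+ size (primes n)
  else 0.

Lemma mobius1 : mobius 1 = 1.
Proof. by []. Qed.

Lemma norm_mobius_le1 n : `|mobius n| <= 1.
Proof. by rewrite /mobius; case: ifP => _; rewrite ?normr0 // normrX normrN1 expr1n. Qed.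

Lemma mobius_mul_prime p n : prime p -> (0 < n)%N ->
  mobius (p * n) = if (p %| n)%N then 0 else - mobius n.
Proof.
move=> p_pr n_gt0; have p_gt0 := prime_gt0 p_pr.
case: (boolP (p %| n)%N) => [pn|pNn].
  rewrite /mobius; case: ifP => // /allP/(_ p).
  rewrite mem_primes p_pr muln_gt0 p_gt0 n_gt0 dvdn_mulr // lognM // => /(_ isT).
  by rewrite logn_prime // eqxx add1n eqSS -leqn0 leqNgt -pfactor_dvdn // expn1 pn.
have pNp : p \notin primes n by rewrite mem_primes (negbTE pNn) !andbF.
have primesM : perm_eq (primes (p * n)) (p :: primes n).
  apply: uniq_perm; rewrite ?primes_uniq //= ?pNp ?primes_uniq // => r.
  by rewrite primesM // in_cons primes_prime // inE.
rewrite /mobius (perm_size primesM) (perm_all _ primesM) /=.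
rewrite lognM // logn_prime // eqxx (lognE p n) p_pr n_gt0 (negbTE pNn) /=.
rewrite exprS mulN1r.
rewrite (@eq_in_all _ _ (fun r => logn r n == 1%N)); last first.
  move=> r rn; rewrite lognM // (logn_prime _ p_pr); case: (eqVneq r p) => // re.
  by rewrite re in rn; rewrite rn in pNp.
by case: ifP; rewrite ?oppr0.
Qed.

Lemma sum_multiples (V : nmodType) (F : nat -> V) p N : (0 < p)%N ->
  \sum_(1 <= d < N.+1 | (p %| d)%N) F d = \sum_(1 <= e < (N %/ p).+1) F (p * e)%N.
Proof.
move=> p_gt0; elim: N => [|N IH]; first by rewrite div0n !big_geq.
rewrite big_mkcond big_nat_recr //= -big_mkcond IH divnS //.
case: ifP => [pN|_] /=; last by rewrite addr0.
rewrite add1n [in RHS]big_nat_recr //=; congr (_ + F _).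
by rewrite -{1}(divnK pN) divnS // pN mulnC.
Qed.

(** For a prime [p] dividing [n], the divisors [p * e] cancel those prime to [p]: [mobius (p * e)]
    is [- mobius e], or 0 when [p] divides [e]. *)
Lemma sum_mobius n : (0 < n)%N ->
  \sum_(1 <= d < n.+1 | (d %| n)%N) mobius d = (n == 1%N)%:R.
Proof.
move=> n_gt0; case: (ltngtP n 1) => // [|n_gt1|->]; last 1 first.
- by rewrite big_mkcond big_nat1.
- by rewrite ltnS leqNgt n_gt0.
pose p := pdiv n; have p_pr : prime p by apply: pdiv_prime.
have p_gt0 := prime_gt0 p_pr; have pn : (p %| n)%N := pdiv_dvd n.
have np_gt0 : (0 < n %/ p)%N by rewrite divn_gt0 //; apply: dvdn_leq.
rewrite (bigID (fun d => p %| d)%N) /= -[RHS](subrr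
  (\sum_(1 <= d < n.+1 | (d %| n)%N && ~~ (p %| d)%N) mobius d)) addrC.
congr (_ + _); rewrite (eq_bigl (fun d => (p %| d)%N && (d %| n)%N)); last first.
  by move=> d; rewrite andbC.
rewrite big_mkcondr sum_multiples // -sumrN.
(* A divisor of [n] prime to [p] divides [n %/ p], so the range can be cut there. *)
rewrite [RHS](eq_bigl (fun e => (((e %| n %/ p) && ~~ (p %| e)) &&
   (e < (n %/ p).+1)))%N); last first.
  move=> e /=; case: (boolP (p %| e)%N) => [|pNe]; first by rewrite !(andbF, andFb).
  have co_pe : coprime e p by rewrite coprime_sym prime_coprime.
  rewrite !andbT -{1}(divnK pn) Gauss_dvdl //.
  by case: (boolP (e %| n %/ p)%N) => //= /(dvdn_leq np_gt0); rewrite ltnS => ->.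
rewrite -(big_nat_widen 1 (n %/ p).+1 n.+1 (fun e => (e %| n %/ p) && ~~ (p %| e))%N)
  ?ltnS ?leq_div // [RHS]big_mkcond.
apply: eq_big_nat => e /andP[e_gt0 _].
rewrite mobius_mul_prime // dvdn_divRL // [(e * p)%N]mulnC.
by case: (_ %| n)%N; case: (p %| e)%N.
Qed.

Section Mangoldt.
Variable R : realType.
Implicit Types n : nat.

(** [primes n] is a singleton exactly when [n] is a prime power with positive exponent. *)
Definition mangoldt n : R := if primes n is [:: p] then ln p%:R else 0.

Lemma mangoldt_ge0 n : 0 <= mangoldt n.
Proof.
rewrite /mangoldt; case E: (primes n) => [//|p [|//]].
have: p \in primes n by rewrite E inE.
rewrite mem_primes => /andP[p_pr _].
by rewrite ln_ge0 // ler1n prime_gt0.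
Qed.

Lemma mangoldt_primeX p k : prime p -> (0 < k)%N -> mangoldt (p ^ k) = ln p%:R.
Proof. by move=> p_pr k_gt0; rewrite /mangoldt primesX // primes_prime. Qed.

Lemma primes1_primeX n p : primes n = [:: p] ->
  [/\ prime p, (0 < logn p n)%N & n = (p ^ logn p n)%N].
Proof.
move=> E; have: p \in primes n by rewrite E inE.
move=> pn; have := pn; rewrite mem_primes => /and3P[p_pr n_gt0 _].
split=> //; first by rewrite logn_gt0.
rewrite -p_part; apply/esym/part_pnat_id.
apply/pnatP => // r r_pr rn.
have: r \in primes n by rewrite mem_primes r_pr n_gt0 rn.
by rewrite E inE => /eqP ->; rewrite inE.
Qed.

(* The divisors of [n] that do not divide [n / p] include exactly one prime
   power, the full power of [p] in [n]. *)
Lemma sum_mangoldt n : (0 < n)%N ->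
  \sum_(1 <= d < n.+1 | (d %| n)%N) mangoldt d = ln n%:R.
Proof.
elim/ltn_ind: n => n IH n_gt0.
have [n_le1|n_gt1] := leqP n 1.
  have -> : n = 1%N by apply/eqP; rewrite eqn_leq n_le1.
  by rewrite ln1 big_mkcond big_nat1.
pose p := pdiv n; have p_pr : prime p by apply: pdiv_prime.
have p_gt0 := prime_gt0 p_pr; have pn : (p %| n)%N := pdiv_dvd n.
have np_gt0 : (0 < n %/ p)%N by rewrite divn_gt0 //; apply: dvdn_leq.
have nE : n = (p * (n %/ p))%N by rewrite mulnC divnK.
have -> : ln n%:R = ln p%:R + ln (n %/ p)%:R :> R.
  by rewrite [in LHS]nE natrM lnM ?posrE ?ltr0n.
rewrite -(IH (n %/ p)%N) // ?ltn_Pdiv ?prime_gt1 //.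
rewrite (bigID (fun d => d %| n %/ p)%N) /= addrC; congr (_ + _); last first.
  rewrite [RHS](big_nat_widen _ _ n.+1) ?ltnS ?leq_div //.
  apply: eq_bigl => d /=; case: (boolP (d %| n %/ p)%N) => dn; last by rewrite andbF.
  by rewrite ltnS (dvdn_leq np_gt0 dn) nE (dvdn_mull p dn).
pose v := logn p n; have v_gt0 : (0 < v)%N by rewrite logn_gt0 mem_primes p_pr n_gt0.
have pvn : (p ^ v %| n)%N by rewrite pfactor_dvdn.
have pvNnp : ~~ (p ^ v %| n %/ p)%N.
  by rewrite dvdn_divRL // -expnSr pfactor_dvdn // ltnn.
rewrite big_mkcond (bigD1_seq (p ^ v)%N) ?iota_uniq //=; last first.
  by rewrite mem_index_iota expn_gt0 p_gt0 ltnS dvdn_leq.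
rewrite pvn pvNnp mangoldt_primeX // big1 ?addr0 // => d dv.
case: ifP => // /andP[dn dNnp].
rewrite /mangoldt; case E: (primes d) => [//|r [|//]].
have [r_pr r_gt0 dE] := primes1_primeX E.
case/negP: dNnp; rewrite dvdn_divRL //.
have [rp|rNp] := eqVneq r p.
  rewrite dE rp -expnSr pfactor_dvdn //.
  have : (logn p d <= v)%N by rewrite -pfactor_dvdn // -rp -dE.
  rewrite leq_eqVlt => /orP[/eqP vE|//].
  by move: dv; rewrite dE rp vE eqxx.
(* A power of a prime other than [p] is coprime to [p], so its product with [p] still divides
   [n]. *)
rewrite Gauss_dvd ?dn //; rewrite dE coprimeXl // prime_coprime //.
by rewrite dvdn_prime2.
Qed.

(** Möbius inversion of [sum_mangoldt]: expand the logarithm, swap the sums, and [sum_mobius] leaves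
    only [e = n]. *)
Lemma mangoldt_mobius n : (0 < n)%N ->
  \sum_(1 <= d < n.+1 | (d %| n)%N) (mobius d)%:~R * ln (n %/ d)%:R = mangoldt n.
Proof.
move=> n_gt0.
transitivity (\sum_(1 <= d < n.+1 | (d %| n)%N)
   \sum_(1 <= e < (n %/ d).+1 | (e %| n %/ d)%N) (mobius d)%:~R * mangoldt e).
  rewrite big_nat_cond [RHS]big_nat_cond; apply: eq_bigr => d /andP[/andP[d_gt0 le_dn] dn].
  by rewrite -mulr_sumr sum_mangoldt // divn_gt0.
rewrite sum_divisors_swap //.
rewrite big_mkcond (bigD1_seq n) ?iota_uniq ?mem_index_iota ?n_gt0 ?leqnn //=.
rewrite dvdnn divnn n_gt0 /= big_mkcond big_nat1 mobius1 mul1r.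
rewrite big_nat_cond big1 ?addr0 // => e /andP[/andP[e_gt0 le_en] eNn].
case: ifP => // en.
rewrite -mulr_suml -raddf_sum /= sum_mobius ?divn_gt0 //.
case: eqP => [E|_]; last by rewrite mul0r.
by move: eNn; rewrite -(divnK en) E mul1n eqxx.
Qed.

End Mangoldt.

(** * Abel summation *)

Section Rcomplex.
Variable R : realType.
Local Notation C := (Rcomplex R).
Local Notation nrm := (@Num.norm R C).
Local Notation Re := (@complex.Re R).
Local Notation Im := (@complex.Im R).
Implicit Types (x y : C) (a : R).

(** [Rcomplex R] has a norm with values in [R], so all estimates below compare reals, and real
    weights act by scaling. *)
Lemma Rcomplex_normE b c : nrm (Complex b c) = Num.sqrt (b ^+ 2 + c ^+ 2).
Proof. by []. Qed.

Lemma Rcomplex_normM x y : nrm (x * y) = nrm x * nrm y.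
Proof. exact: ComplexField.Normc.normcM. Qed.

Lemma Rcomplex_normZ a x : nrm (a *: x) = `|a| * nrm x.
Proof.
case: x => b c; rewrite -[a *: _]/(Complex (a * b) (a * c)) !Rcomplex_normE.
by rewrite !exprMn -mulrDr sqrtrM ?sqr_ge0 // sqrtr_sqr.
Qed.

Lemma Rcomplex_norm1 : nrm 1 = 1.
Proof. exact: ComplexField.Normc.normc1. Qed.

Lemma Rcomplex_scaleAr a x y : x * (a *: y) = a *: (x * y).
Proof. by rewrite mulrC -scalerAl mulrC. Qed.

Lemma le_Re_norm x : `|Re x| <= nrm x.
Proof.
case: x => b c; rewrite Rcomplex_normE /= -sqrtr_sqr ler_wsqrtr //.
by rewrite lerDl sqr_ge0.
Qed.

Lemma le_Im_norm x : `|Im x| <= nrm x.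
Proof.
case: x => b c; rewrite Rcomplex_normE /= -sqrtr_sqr ler_wsqrtr //.
by rewrite lerDr sqr_ge0.
Qed.

Lemma Rcomplex_norm_le x : nrm x <= `|Re x| + `|Im x|.
Proof.
case: x => b c; rewrite Rcomplex_normE /=.
rewrite -[leRHS]ger0_norm ?addr_ge0 // -sqrtr_sqr ler_wsqrtr //.
rewrite sqrrD -!normrX (ger0_norm (sqr_ge0 b)) (ger0_norm (sqr_ge0 c)).
by rewrite -addrA lerD2l lerDr mulrn_wge0 // mulr_ge0.
Qed.

(** The intervals of centre [s n] and radius [e n] meet pairwise; the supremum of their lower ends
    lies in all of them. *)
Lemma real_tail_limit (s e : nat -> R) :
  (forall m n, (m <= n)%N -> `|s n - s m| <= e m) ->
  exists L, forall n, `|s n - L| <= e n.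
Proof.
move=> tail.
have cross m n : s m - e m <= s n + e n.
  have [mn|/ltnW nm] := leqP m n; [have := tail _ _ mn|have := tail _ _ nm];
  rewrite ler_norml => /andP[];
  have := le_trans (normr_ge0 _) (tail _ _ (leqnn m));
  have := le_trans (normr_ge0 _) (tail _ _ (leqnn n)); lra.
pose E := [set y | exists n, y = s n - e n]%classic.
have supE : has_sup E.
  split; first by exists (s 0%N - e 0%N), 0%N.
  by exists (s 0%N + e 0%N) => _ [m ->].
exists (sup E) => n; rewrite ler_distl; apply/andP; split.
  rewrite lerBlDr; apply: ge_sup; first by case: supE.
  by move=> _ [m ->].
rewrite -lerBlDr; apply: sup_upper_bound => //; by exists n.
Qed.

(** The factor 2 comes from treating real and imaginary parts separately. *)
Lemma Rcomplex_tail_limit (s : nat -> C) (e : nat -> R) :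
  (forall m n, (m <= n)%N -> nrm (s n - s m) <= e m) ->
  exists L : C, forall n, nrm (s n - L) <= 2 * e n.
Proof.
move=> tail.
have [|Lr HLr] := @real_tail_limit (fun n => Re (s n)) e.
  move=> m n mn; rewrite -raddfB; apply: le_trans (tail _ _ mn); exact: le_Re_norm.
have [|Li HLi] := @real_tail_limit (fun n => Im (s n)) e.
  move=> m n mn; rewrite -raddfB; apply: le_trans (tail _ _ mn); exact: le_Im_norm.
exists (Complex Lr Li) => n; apply: le_trans (Rcomplex_norm_le _) _.
rewrite !raddfB /= mulr2n mulrDl mul1r; exact: lerD.
Qed.

Lemma abel_bound (chi : nat -> C) (K : R) (w : nat -> R) (a b : nat) :
  (forall m n, nrm (\sum_(m <= k < n) chi k) <= K) ->
  (forall n, (a <= n)%N -> 0 <= w n.+1 <= w n) -> (a <= b)%N -> 0 <= w a ->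
  nrm (\sum_(a <= n < b) w n *: chi n) <= K * w a.
Proof.
move=> bnd anti; set S := fun b => \sum_(a <= n < b) w n *: chi n.
set U := fun b => \sum_(a <= n < b) chi n.
move=> ab wa0.
(* Summation by parts: each step adds [(w n - w n.+1) *: U n.+1], of norm at most [K] times the drop
   of [w], and the drops telescope. *)
have step k : nrm (S (a + k)%N - w (a + k)%N *: U (a + k)%N) <= K * (w a - w (a + k)%N).
  elim: k => [|k IH].
    by rewrite addn0 /S /U !big_geq // scaler0 !subrr normr0 mulr0.
  set n := (a + k)%N in IH *; have an : (a <= n)%N by rewrite leq_addr.
  rewrite addnS -/n.
  have -> : S n.+1 - w n.+1 *: U n.+1 =
      (S n - w n *: U n) + (w n - w n.+1) *: U n.+1.
    rewrite /S /U !big_nat_recr //=; set s := \sum_(_ <= _ < _) _ *: _.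
    set u := \sum_(_ <= _ < _) _.
    by rewrite scalerBl !scalerDr; ring.
  have /andP[_ wd] := anti n an.
  have := bnd a n.+1; rewrite -/(U n.+1) => HU.
  apply: le_trans (ler_normD _ _) _; rewrite Rcomplex_normZ.
  rewrite (ger0_norm (_ : 0 <= w n - w n.+1)) ?subr_ge0 //.
  have : (w n - w n.+1) * nrm (U n.+1) <= (w n - w n.+1) * K.
    by rewrite ler_wpM2l // subr_ge0.
  move: IH; lra.
have {}step := step (b - a)%N; rewrite subnKC // in step.
have wb0 : 0 <= w b.
  case: (b) ab => [|m]; first by rewrite leqn0 => /eqP <-.
  by rewrite leq_eqVlt => /orP[/eqP <- //|]; rewrite ltnS => /anti/andP[].
have Ub := bnd a b.
rewrite -[X in nrm X]/(S b) -[S b](subrK (w b *: U b)); apply: le_trans (ler_normD _ _) _.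
rewrite Rcomplex_normZ (ger0_norm wb0).
have : w b * nrm (U b) <= w b * K by rewrite ler_wpM2l.
by move: step; lra.
Qed.

(** By [abel_bound], the partial sums after [m] differ from the one at [m] by at most
    [K * w m.+1]. *)
Lemma abel_limit (chi : nat -> C) (K : R) (w : nat -> R) :
  (forall m n, nrm (\sum_(m <= k < n) chi k) <= K) ->
  (forall n, (0 < n)%N -> 0 <= w n.+1 <= w n) ->
  exists L : C, forall N,
    nrm (\sum_(1 <= n < N.+1) w n *: chi n - L) <= 2 * (K * w N.+1).
Proof.
move=> bnd anti.
have w_ge0 n : (0 < n)%N -> 0 <= w n.
  by move=> /anti/andP[]; exact: le_trans.
apply: (@Rcomplex_tail_limit _ (fun N => K * w N.+1)) => m n mn.
rewrite (@big_cat_nat _ _ _ m.+1) //= addrAC subrr add0r.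
apply: abel_bound => //; last exact: w_ge0.
by move=> k mk; apply: anti; apply: leq_trans mk.
Qed.

End Rcomplex.

(** * Logarithmic sums *)

Section Logarithm.
Variable R : realType.
Implicit Types x y : R.

Lemma ln_leB1 x : 0 < x -> ln x <= x - 1.
Proof.
by move=> x_gt0; have := @le_ln1Dx R (x - 1); rewrite addrCA subrr addr0; apply; lra.
Qed.

Lemma ln_natS n : (0 < n)%N -> n%:R * (ln n.+1%:R - ln n%:R) <= 1 :> R.
Proof.
move=> n_gt0; have n0 : 0 < n%:R :> R by rewrite ltr0n.
rewrite -ln_div ?posrE ?ltr0n //.
have := @ln_leB1 (n.+1%:R / n%:R); rewrite divr_gt0 ?ltr0n // => /(_ isT).
move=> /(ler_wpM2l (ltW n0)) H; apply: le_trans H _.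
rewrite mulrBr mulr1 mulrCA divff ?gt_eqF // mulr1 -natr1; lra.
Qed.

Lemma sum_const_from1 N x : \sum_(1 <= d < N.+1) x = N%:R * x.
Proof. by rewrite sumr_const_nat subSS subn0 mulr_natl. Qed.

(** A weak form of Stirling's formula: passing from [N] to [N.+1] adds [N * ln (1 + 1 / N)], at most
    1. *)
Lemma sum_ln_quotient_le N :
  \sum_(1 <= d < N.+1) (ln N%:R - ln d%:R) <= N%:R :> R.
Proof.
elim: N => [|N IH]; first by rewrite big_geq.
rewrite big_nat_recr //= subrr addr0.
have -> : \sum_(1 <= d < N.+1) (ln N.+1%:R - ln d%:R) =
  \sum_(1 <= d < N.+1) (ln N%:R - ln d%:R) + N%:R * (ln N.+1%:R - ln N%:R) :> R.
  by rewrite -sum_const_from1 -big_split /=; apply: eq_bigr => d _; ring.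
rewrite -[leRHS]natr1; apply: lerD => //.
by case: N {IH} => [|N]; [rewrite mul0r|exact: ln_natS].
Qed.

Lemma sum_ln_ge N : (0 < N)%N ->
  N%:R * (ln N%:R - 1) <= \sum_(1 <= d < N.+1) ln d%:R :> R.
Proof.
move=> N_gt0; have := sum_ln_quotient_le N.
rewrite sumrB sum_const_from1; lra.
Qed.

Lemma sum_ln_le N : \sum_(1 <= d < N.+1) ln d%:R <= N%:R * ln N%:R :> R.
Proof.
rewrite -sum_const_from1.
apply: ler_sum_nat => d /andP[d_gt0 dN].
rewrite ler_ln ?posrE ?ltr0n ?ler_nat //; exact: leq_trans d_gt0 dN.
Qed.

(** The summand 1 makes the quotient decrease from 1 on, whereas [ln x / x] increases up to [e];
    Abel summation can thus start at 1. *)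
Lemma ln1D_div_antitone x y : 1 <= x -> x <= y -> (1 + ln y) / y <= (1 + ln x) / x.
Proof.
move=> x1 xy; have x0 : 0 < x by lra. have y0 : 0 < y by lra.
have lny : ln y <= ln x + (y / x - 1).
  rewrite -lerBlDl -ln_div ?posrE //; apply: ln_leB1; exact: divr_gt0.
rewrite ler_pdivrMr // mulrAC -[leRHS]mulrA.
have q1 : 1 <= y / x by rewrite ler_pdivlMr // mul1r.
have := ln_ge0 x1 => l0.
have : ln x * 1 <= ln x * (y / x) by rewrite ler_wpM2l.
rewrite mulrDl mul1r; lra.
Qed.

(** Both sides are the logarithm of the factorial of [N]: each [n] divides [N %/ n] of the integers
    up to [N]. *)
Lemma sum_mangoldt_floor N :
  \sum_(1 <= n < N.+1) mangoldt R n *+ (N %/ n) = \sum_(1 <= n < N.+1) ln n%:R.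
Proof.
have <- : \sum_(1 <= n < N.+1) \sum_(1 <= d < n.+1 | (d %| n)%N) mangoldt R d =
          \sum_(1 <= n < N.+1) ln n%:R.
  by apply: eq_big_nat => n /andP[n_gt0 _]; rewrite sum_mangoldt.
rewrite -(sum_divisors_exchange (fun d m => mangoldt R d)).
by apply: eq_bigr => n _; rewrite sumr_const_nat subSS subn0.
Qed.

Lemma sum_mangoldt_div_ge N : (0 < N)%N ->
  ln N%:R - 1 <= \sum_(1 <= n < N.+1) mangoldt R n / n%:R.
Proof.
move=> N_gt0; have N0 : 0 < N%:R :> R by rewrite ltr0n.
rewrite -(ler_pM2l N0); apply: le_trans (sum_ln_ge N_gt0) _.
rewrite -sum_mangoldt_floor mulr_sumr; apply: ler_sum_nat => n /andP[n_gt0 _].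
rewrite mulrCA -[mangoldt R n *+ _]mulr_natr ler_wpM2l ?mangoldt_ge0 //.
by rewrite ler_pdivlMr ?ltr0n // -natrM ler_nat leq_trunc_div.
Qed.

(* For [n <= N] we have [2 N / n >= 2], hence [floor (2 N / n) >= 2/3 * (2 N / n)]. *)
Lemma sum_mangoldt_div_le N : (0 < N)%N ->
  \sum_(1 <= n < N.+1) mangoldt R n / n%:R <= 3 / 2 * (ln N%:R + ln 2).
Proof.
move=> N_gt0; have N0 : 0 < N%:R :> R by rewrite ltr0n.
(* [4 / 3] is twice the [2 / 3] lost to the floor. Any leading constant below 2 would do later,
   against two characters contributing [- ln N] each. *)
have N20 : 0 < (4 / 3) * N%:R :> R by lra.
rewrite -(ler_pM2l N20).
apply: (@le_trans _ _ ((2 * N)%N%:R * ln (2 * N)%N%:R)); last first.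
  by rewrite natrM lnM ?posrE ?ltr0n //; lra.
apply: le_trans (sum_ln_le _); rewrite -sum_mangoldt_floor.
rewrite [leRHS](@big_cat_nat _ _ _ N.+1) //=; last by rewrite ltnS leq_pmull.
rewrite ler_wpDr ?sumr_ge0 // => [n _|]; first by rewrite mulrn_wge0 ?mangoldt_ge0.
rewrite mulr_sumr; apply: ler_sum_nat => n /andP[n_gt0 nN].
rewrite mulrCA -[mangoldt R n *+ _]mulr_natr ler_wpM2l ?mangoldt_ge0 //.
rewrite ler_pdivrMr ?ltr0n // -natrM mulrAC ler_pdivrMr ?ltr0n // -!natrM ler_nat.
rewrite ltnS in nN.
have := divn_eq (2 * N) n; have := ltn_pmod (2 * N) n_gt0.
have : (2 <= 2 * N %/ n)%N by rewrite leq_divRL // leq_mul2l.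
nia.
Qed.

(** The right side is the sum of the whole geometric series. *)
Lemma sum_invX_le p K : (1 < p)%N ->
  \sum_(2 <= k < K) (p ^ k)%:R^-1 <= (p%:R * (p%:R - 1))^-1 :> R.
Proof.
move=> p_gt1; have p1 : 1 < p%:R :> R by rewrite ltr1n.
have q0 : 0 < (p%:R * (p%:R - 1))^-1 :> R by rewrite invr_gt0 mulr_gt0; lra.
suff H n : \sum_(2 <= k < n.+2) (p ^ k)%:R^-1 =
    (1 - p%:R ^- n) * (p%:R * (p%:R - 1))^-1 :> R.
  case: K => [|[|n]]; [by rewrite big_geq // ltW..|].
  rewrite H; apply: ler_piMl; first exact: ltW.
  by rewrite gerBl invr_ge0 exprn_ge0 //; lra.
elim: n => [|n IH]; first by rewrite big_geq // expr0 invr1 subrr mul0r.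
rewrite big_nat_recr //= IH natrX !exprS; field.
by rewrite expf_neq0 ?andbT; lra.
Qed.

Lemma sum_ln_div_le M :
  \sum_(2 <= m < M.+1) ln m%:R / (m%:R * (m%:R - 1)) <= 2 :> R.
Proof.
case: M => [|M]; first by rewrite big_geq.
(* Strengthened for induction: [(ln n + 2) / n] drops from [n] to [n + 1] by at least the summand at
   [n + 1]. *)
suff H : \sum_(2 <= m < M.+2) ln m%:R / (m%:R * (m%:R - 1)) <=
    2 - (ln M.+1%:R + 2) / M.+1%:R :> R.
  apply: le_trans H _; rewrite gerBl divr_ge0 // addr_ge0 // ln_ge0 // ler1n //.
elim: M => [|M IH]; first by rewrite big_geq // ln1; lra.
rewrite big_nat_recr //=; set l2 := ln M.+2%:R; set l1 := ln M.+1%:R in IH *.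
have := @ln_natS M.+1 isT; rewrite -/l1 -/l2.
have : l2 - l1 <= 1.
  have := @ln_natS M.+1 isT; rewrite -/l1 -/l2; apply: le_trans.
  rewrite ler_peMl // ?ler1n // subr_ge0 ler_ln ?posrE ?ltr0n // ler_nat //.
have -> : M.+2%:R = M.+1%:R + 1 :> R by rewrite natr1.
have : 1 <= M.+1%:R :> R by rewrite ler1n.
move: IH; set m : R := M.+1%:R => IH m1 h1 h2; rewrite addrK.
suff : l2 / ((m + 1) * m) <= (l1 + 2) / m - (l2 + 2) / (m + 1).
  by move=> /(lerD IH) H; rewrite addrA subrK in H.
have -> : (l1 + 2) / m - (l2 + 2) / (m + 1) =
    ((m + 1) * (l1 + 2) - m * (l2 + 2)) / ((m + 1) * m).
  by field; apply/andP; split; lra.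
rewrite ler_pM2r ?invr_gt0 ?mulr_gt0 //; lra.
Qed.

(** The powers of [p] with exponent at least 2 contribute at most [ln p / (p (p - 1))]; the bases
    are then enlarged from primes to all integers from 2 on. *)
Lemma sum_mangoldt_nonprime_le N :
  \sum_(1 <= n < N.+1 | ~~ prime n) mangoldt R n / n%:R <= 2.
Proof.
pose F p k : R := ln p%:R / (p ^ k)%:R.
have F_ge0 p k : (1 < p)%N -> 0 <= F p k.
  by move=> p_gt1; rewrite divr_ge0 // ln_ge0 // ler1n ltnW.
apply: le_trans (sum_ln_div_le N).
apply: (@le_trans _ _ (\sum_(2 <= p < N.+1) \sum_(2 <= k < N.+1) F p k)); last first.
  apply: ler_sum_nat => p /andP[p_gt1 _]; rewrite -mulr_sumr.
  by rewrite ler_wpM2l ?sum_invX_le // ln_ge0 // ler1n ltnW.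
apply: (@le_trans _ _ (\sum_(1 <= n < N.+1) \sum_(2 <= p < N.+1)
    \sum_(2 <= k < N.+1 | (p ^ k == n)%N) F p k)).
  rewrite big_mkcond; apply: ler_sum_nat => n /andP[n_gt0 nN].
  have RHS_ge0 : 0 <= \sum_(2 <= p < N.+1)
      \sum_(2 <= k < N.+1 | (p ^ k == n)%N) F p k.
    rewrite big_nat_cond sumr_ge0 // => p /andP[/andP[p_gt1 _] _].
    by rewrite sumr_ge0 // => k _; exact: F_ge0.
  case: ifP => // n_npr; rewrite /mangoldt.
  case E: (primes n) => [|p [|? ?]]; rewrite ?mul0r //.
  have [p_pr k_gt0 nE] := primes1_primeX E; set k := logn p n in k_gt0 nE.
  have p_gt1 := prime_gt1 p_pr.
  have k_gt1 : (1 < k)%N.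
    case: k k_gt0 nE => [//|[|//]] _; rewrite expn1 => nE.
    by rewrite nE p_pr in n_npr.
  have pN : (p < N.+1)%N.
    by apply: leq_trans nN; rewrite ltnS nE -{1}(expn1 p) leq_exp2l.
  have kN : (k < N.+1)%N by apply: leq_trans nN; rewrite nE ltnS ltnW // ltn_expl.
  rewrite (bigD1_seq p) ?iota_uniq ?mem_index_iota ?p_gt1 ?pN //=.
  rewrite ler_wpDr //; last first.
    rewrite big_mkcond (bigD1_seq k) ?iota_uniq ?mem_index_iota ?k_gt1 ?kN //=.
    rewrite -nE eqxx /F -nE lerDl sumr_ge0 // => j _.
    by case: ifP => // _; exact: F_ge0.
  rewrite big_nat_cond sumr_ge0 // => r /andP[/andP[r_gt1 _] _].
  by rewrite sumr_ge0 // => j _; exact: F_ge0.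
rewrite exchange_big_nat /=; apply: ler_sum_nat => p /andP[p_gt1 _].
rewrite (exchange_big_dep_nat xpredT) //=; apply: ler_sum_nat => k _.
rewrite big_mkcond.
have [H|H] := boolP (p ^ k \in index_iota 1 N.+1)%N.
  rewrite (bigD1_seq _ H) ?iota_uniq //= eqxx big1 ?addr0 // => n.
  by rewrite eq_sym => /negbTE ->.
rewrite big1_seq ?F_ge0 // => n /= nin; case: eqP => // E.
by rewrite E nin in H.
Qed.

End Logarithm.

(** * Sums twisted by a completely multiplicative function *)

Section CompletelyMultiplicative.
Variables (R : realType) (chi : nat -> Rcomplex R) (K : R).
Local Notation C := (Rcomplex R).
Local Notation nrm := (@Num.norm R C).
Hypothesis chi1 : chi 1 = 1.
Hypothesis chiM : forall m n, chi (m * n) = chi m * chi n.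
Hypothesis norm_chi : forall n, nrm (chi n) <= 1.
Hypothesis sum_chi : forall m n, nrm (\sum_(m <= k < n) chi k) <= K.

Let K_ge0 : 0 <= K.
Proof. exact: le_trans (normr_ge0 _) (sum_chi 0 0). Qed.

(** Complete multiplicativity merges [chi d * chi m] into [chi (d * m)], so grouping by the product
    yields a Dirichlet convolution. *)
Lemma twisted_convolution (f g : nat -> R) N :
  \sum_(1 <= d < N.+1) ((f d / d%:R) *: chi d) *
     (\sum_(1 <= m < (N %/ d).+1) (g m / m%:R) *: chi m) =
  \sum_(1 <= n < N.+1)
     ((\sum_(1 <= d < n.+1 | (d %| n)%N) f d * g (n %/ d)%N) / n%:R) *: chi n.
Proof.
under eq_bigr => d _ do rewrite mulr_sumr.
rewrite (sum_divisors_exchange (fun d m => ((f d / d%:R) *: chi d) * ((g m / m%:R) *: chi m))).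
apply: eq_big_nat => n /andP[n_gt0 _]; rewrite mulr_suml scaler_suml.
rewrite big_nat_cond [RHS]big_nat_cond; apply: eq_bigr => d /andP[/andP[d_gt0 _] dn].
rewrite -scalerAl Rcomplex_scaleAr scalerA -chiM mulnC divnK //; congr (_ *: _).
have nE : n%:R = (n %/ d)%N%:R * d%:R :> R by rewrite -natrM divnK.
have : d%:R != 0 :> R by rewrite pnatr_eq0 -lt0n.
have : (n %/ d)%N%:R != 0 :> R by rewrite pnatr_eq0 -lt0n divn_gt0 // dvdn_leq.
by rewrite nE => h1 h2; field; rewrite ?h1 ?h2.
Qed.

Local Notation mu d := ((mobius d)%:~R : R).
Local Notation T N := (\sum_(1 <= n < N.+1) (mangoldt R n / n%:R) *: chi n).
Local Notation s N := (\sum_(1 <= n < N.+1) (1 / n%:R) *: chi n).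
Local Notation b N := (\sum_(1 <= n < N.+1) ((1 + ln n%:R) / n%:R) *: chi n).

Let mu1 n : (0 < n)%N -> \sum_(1 <= d < n.+1 | (d %| n)%N) mu d = (n == 1%N)%:R.
Proof. by move=> n_gt0; rewrite -raddf_sum /= sum_mobius // natz; case: (n == 1%N). Qed.

Let sum_at1 N (c : R) : (0 < N)%N ->
  \sum_(1 <= n < N.+1) (((n == 1%N)%:R * c) / n%:R) *: chi n = c *: 1.
Proof.
move=> N_gt0; rewrite big_ltn // eqxx mul1r divr1 chi1 big_nat_cond big1 ?addr0 //.
by move=> [|[|n]] //= _; rewrite mul0r mul0r scale0r.
Qed.

Lemma twisted_mobius_inverse N : (0 < N)%N ->
  \sum_(1 <= d < N.+1) ((mu d / d%:R) *: chi d) * s (N %/ d) = 1.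
Proof.
move=> N_gt0; rewrite (twisted_convolution (fun d => mu d) (fun=> 1)).
rewrite -[RHS]scale1r -(sum_at1 _ N_gt0); apply: eq_big_nat => n /andP[n_gt0 _].
by rewrite -mulr_suml mu1.
Qed.

(** Möbius inversion of [1 + ln n] gives the von Mangoldt function plus the indicator of 1, hence
    the [+ 1]. *)
Lemma twisted_mobius_ln N : (0 < N)%N ->
  \sum_(1 <= d < N.+1) ((mu d / d%:R) *: chi d) * b (N %/ d) = T N + 1.
Proof.
move=> N_gt0; rewrite (twisted_convolution (fun d => mu d) (fun n => 1 + ln n%:R)).
rewrite -[X in _ + X]scale1r -(sum_at1 _ N_gt0) -big_split /=.
apply: eq_big_nat => n /andP[n_gt0 _]; rewrite -scalerDl -mulrDl.
congr ((_ / _) *: _); under eq_bigr => d _ do rewrite mulrDr.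
by rewrite big_split /= -mulr_suml mu1 // mangoldt_mobius // addrC.
Qed.

(** Split [ln (N / d)] as [ln (n / d) + ln (N / n)]: the first part inverts to the von Mangoldt
    function, the second survives only at [n = 1]. *)
Lemma twisted_mobius_ln_quotient N : (0 < N)%N ->
  \sum_(1 <= d < N.+1) ((mu d * (ln N%:R - ln d%:R) / d%:R) *: chi d) * s (N %/ d) =
  T N + ln N%:R *: 1.
Proof.
move=> N_gt0.
rewrite (twisted_convolution (fun d => mu d * (ln N%:R - ln d%:R)) (fun=> 1)).
rewrite -(sum_at1 _ N_gt0) -big_split /=.
apply: eq_big_nat => n /andP[n_gt0 _]; rewrite -scalerDl -mulrDl.
congr ((_ / _) *: _).
have -> : \sum_(1 <= d < n.+1 | (d %| n)%N) mu d * (ln N%:R - ln d%:R) * 1 =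
  \sum_(1 <= d < n.+1 | (d %| n)%N)
     (mu d * ln (n %/ d)%N%:R + mu d * (ln N%:R - ln n%:R)).
  rewrite big_nat_cond [RHS]big_nat_cond.
  apply: eq_bigr => d /andP[/andP[d_gt0 dn1] dn].
  have nE : n%:R = (n %/ d)%N%:R * d%:R :> R by rewrite -natrM divnK.
  have -> : ln n%:R = ln (n %/ d)%N%:R + ln d%:R :> R.
    by rewrite nE lnM ?posrE ?ltr0n // divn_gt0.
  ring.
rewrite big_split /= mangoldt_mobius // -mulr_suml mu1 //; congr (_ + _).
by case: eqP => [->|]; rewrite ?mul0r // ln1 subr0.
Qed.

Let normmu d : `|mu d| <= 1.
Proof. by rewrite -intr_norm -[leRHS]/(1%:~R) ler_int norm_mobius_le1. Qed.

Let norm_term_le (f c e : R) (z : C) d : (0 < d)%N -> `|f| <= c -> nrm z <= e * d%:R ->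
  nrm (((f / d%:R) *: chi d) * z) <= c * e.
Proof.
move=> d_gt0 hf hz; have d0 : 0 < d%:R :> R by rewrite ltr0n.
rewrite Rcomplex_normM Rcomplex_normZ normrM normfV (gtr0_norm d0).
have -> : c * e = c / d%:R * 1 * (e * d%:R) by field; rewrite gt_eqF.
apply: ler_pM => //; first by rewrite !mulr_ge0 // invr_ge0 ltW.
apply: ler_pM => //; first by rewrite mulr_ge0 // invr_ge0 ltW.
by rewrite ler_pM2r ?invr_gt0.
Qed.

Let quoS_ge N d : (0 < d)%N -> N%:R / d%:R <= (N %/ d).+1%:R :> R.
Proof.
move=> d_gt0; rewrite ler_pdivrMr ?ltr0n // -natrM ler_nat ltnW //.
by rewrite [in ltnLHS](divn_eq N d) mulSn addnC ltn_add2r ltn_pmod.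
Qed.

(* With [L] the sum of the series [chi n / n]: if [L <> 0], then
   [\sum_d mu d * chi d / d] is bounded and so is [T]; if [L = 0], the partial
   sums [s] are small enough to make [twisted_mobius_ln_quotient] bounded. *)
Lemma twisted_mangoldt_dichotomy :
  (exists B : R, forall N, (0 < N)%N -> nrm (T N) <= B) \/
  ((exists B : R, forall N, (0 < N)%N -> nrm (T N + ln N%:R *: 1) <= B) /\
   (exists B : R, forall N, nrm (s N) <= B / N.+1%:R)).
Proof.
have [|L HL] := abel_limit (w := fun n => 1 / n%:R) sum_chi.
  move=> n n_gt0; rewrite divr_ge0 //= ler_pM2l // lef_pV2 ?posrE ?ltr0n //.
  by rewrite ler_nat.
have [|L1 HL1] := abel_limit (w := fun n => (1 + ln n%:R) / n%:R) sum_chi.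
  move=> n n_gt0; rewrite divr_ge0 ?addr_ge0 ?ln_ge0 ?ler1n //=.
  by apply: ln1D_div_antitone; rewrite ?ler1n ?ler_nat.
(* The factor [d] will cancel the [1 / d] of the summand, so that [N] such errors add up to at most
   [2 * K]. *)
have L_quo N d : (0 < d)%N -> (0 < N)%N ->
    nrm (s (N %/ d) - L) <= (2 * K / N%:R) * d%:R.
  move=> d_gt0 N_gt0; apply: le_trans (HL _) _.
  have d0 : 0 < d%:R :> R by rewrite ltr0n.
  have N0 : 0 < N%:R :> R by rewrite ltr0n.
  rewrite -!mulrA ler_wpM2l // ler_wpM2l // mul1r.
  rewrite -[leRHS]invrK invfM invrK lef_pV2 ?posrE ?ltr0n ?divr_gt0 //.
  exact: quoS_ge.
have [L0|L_neq0] := eqVneq L 0.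
  right; split.
    exists (2 * K) => N N_gt0; have N0 : 0 < N%:R :> R by rewrite ltr0n.
    rewrite -twisted_mobius_ln_quotient //; apply: le_trans (ler_norm_sum _ _ _) _.
    apply: (@le_trans _ _ (\sum_(1 <= d < N.+1) (ln N%:R - ln d%:R) * (2 * K / N%:R))).
      apply: ler_sum_nat => d /andP[d_gt0 dN].
      have lnd : 0 <= ln N%:R - ln d%:R :> R.
        by rewrite subr_ge0 ler_ln ?posrE ?ltr0n ?ler_nat.
      apply: norm_term_le => //; last by have := L_quo N d d_gt0 N_gt0; rewrite L0 subr0.
      by rewrite normrM (ger0_norm lnd) ler_piMl.
    rewrite -mulr_suml; have := sum_ln_quotient_le R N.
    have q0 : 0 <= 2 * K / N%:R by rewrite divr_ge0 ?mulr_ge0.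
    move=> /(ler_wpM2r q0) H; apply: le_trans H _.
    by rewrite mulrCA divff ?mulr1 // gt_eqF.
  exists (2 * K) => N; have := HL N; rewrite L0 subr0 => H; apply: le_trans H _.
  by rewrite mul1r mulrA.
left.
have Lpos : 0 < nrm L by rewrite normr_gt0.
(* Replacing [s (N %/ d)] by [L] in [twisted_mobius_inverse] costs at most [2 * K], which bounds
   [M N * L]. *)
pose M N := \sum_(1 <= d < N.+1) (mu d / d%:R) *: chi d.
have M_le N : (0 < N)%N -> nrm (M N) <= (1 + 2 * K) / nrm L.
  move=> N_gt0; have N0 : 0 < N%:R :> R by rewrite ltr0n.
  rewrite ler_pdivlMr // -Rcomplex_normM.
  have -> : M N * L = 1 -
      \sum_(1 <= d < N.+1) ((mu d / d%:R) *: chi d) * (s (N %/ d) - L).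
    rewrite -(twisted_mobius_inverse N_gt0) -sumrB mulr_suml.
    by apply: eq_bigr => d _; rewrite -mulrBr opprB addrC subrK.
  apply: le_trans (ler_normB _ _) _; rewrite Rcomplex_norm1 lerD2l.
  apply: le_trans (ler_norm_sum _ _ _) _.
  apply: (@le_trans _ _ (\sum_(1 <= d < N.+1) 1 * (2 * K / N%:R))).
    by apply: ler_sum_nat => d /andP[d_gt0 dN]; apply: norm_term_le => //; exact: L_quo.
  by rewrite sum_const_from1 mul1r mulrCA divff ?mulr1 // gt_eqF.
(* The terms come from the [+ 1] in [twisted_mobius_ln], from replacing [b (N %/ d)] by [L1], and
   from the errors of that replacement, at most [2 * K / N] times [2 * N]. *)
exists (1 + nrm L1 * ((1 + 2 * K) / nrm L) + 4 * K) => N N_gt0.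
have N0 : 0 < N%:R :> R by rewrite ltr0n.
have -> : T N = - 1 + L1 * M N +
    \sum_(1 <= d < N.+1) ((mu d / d%:R) *: chi d) * (b (N %/ d) - L1).
  rewrite -[LHS](addrK 1) -(twisted_mobius_ln N_gt0) mulr_sumr addrC -addrA.
  congr (_ + _); rewrite -big_split /=; apply: eq_bigr => d _.
  by rewrite mulrBr [L1 * _]mulrC addrC subrK.
apply: le_trans (ler_normD _ _) _; apply: lerD.
  apply: le_trans (ler_normD _ _) _; rewrite normrN Rcomplex_norm1 lerD2l.
  by rewrite Rcomplex_normM ler_wpM2l // M_le.
apply: le_trans (ler_norm_sum _ _ _) _.
apply: (@le_trans _ _ (\sum_(1 <= d < N.+1)
    1 * (2 * K / N%:R * (1 + (ln N%:R - ln d%:R))))).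
  apply: ler_sum_nat => d /andP[d_gt0 dN]; apply: norm_term_le => //.
  have d0 : 0 < d%:R :> R by rewrite ltr0n.
  apply: le_trans (HL1 _) _.
  rewrite -!mulrA ler_wpM2l // ler_wpM2l //.
  apply: (@le_trans _ _ ((1 + ln (N%:R / d%:R)) / (N%:R / d%:R))).
    apply: ln1D_div_antitone; last exact: quoS_ge.
    by rewrite ler_pdivlMr // mul1r ler_nat.
  rewrite ln_div ?posrE // invfM invrK le_eqVlt; apply/orP; left; apply/eqP; ring.
rewrite -!mulr_sumr mul1r big_split /= sum_const_from1 mulr1.
have := sum_ln_quotient_le R N => H.
have q0 : 0 <= 2 * K / N%:R by rewrite divr_ge0 ?mulr_ge0.
apply: (@le_trans _ _ (2 * K / N%:R * (N%:R + N%:R))).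
  by rewrite ler_wpM2l // lerD2l.
by rewrite le_eqVlt; apply/orP; left; apply/eqP; field; rewrite gt_eqF.
Qed.

End CompletelyMultiplicative.

(** * Real characters *)

Section GeometricSums.
Variable R : realType.
Implicit Types x y : R.

Definition geom_sum x n := \sum_(0 <= i < n) x ^+ i.

Lemma geom_sumS x n : geom_sum x n.+1 = 1 + x * geom_sum x n.
Proof.
rewrite /geom_sum big_nat_recl //= expr0 mulr_sumr; congr (_ + _).
by apply: eq_bigr => i _; rewrite exprS.
Qed.

Lemma geom_sumSr x n : geom_sum x n.+1 = geom_sum x n + x ^+ n.
Proof. by rewrite /geom_sum big_nat_recr. Qed.

Lemma geom_sumE x n : (1 - x) * geom_sum x n = 1 - x ^+ n.
Proof.
elim: n => [|n IH]; first by rewrite /geom_sum big_geq // mulr0 expr0 subrr.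
by rewrite geom_sumSr mulrDr IH exprS; ring.
Qed.

(* Pairing the first and the last term, by AM-GM. *)
Lemma geom_sum_sqr_ge y n : 0 <= y -> n.+1%:R * y ^+ n <= geom_sum (y ^+ 2) n.+1.
Proof.
move=> y0; elim/ltn_ind: n => -[|[|k]] IH.
- by rewrite /geom_sum big_nat1 !expr0 mul1r.
- rewrite geom_sumSr /geom_sum big_nat1 expr0 !expr1; have := sqr_ge0 (y - 1); lra.
rewrite geom_sumSr geom_sumS.
have H1 := ler_wpM2l (sqr_ge0 y) (IH k (leqW (leqnn _))).
have -> : k.+3%:R = k.+1%:R + 2 :> R by rewrite -natrD addn2.
have H2 := sqr_ge0 (y ^+ k.+2 - 1).
have E : y ^+ 2 * (k.+1%:R * y ^+ k) = k.+1%:R * y ^+ k.+2 by rewrite !exprS; ring.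
have E2 : (y ^+ 2) ^+ k.+2 = (y ^+ k.+2) ^+ 2 by rewrite -!exprM mulnC.
rewrite E2; move: H1 H2; rewrite E; set z := y ^+ k.+2; nra.
Qed.

(** For [0 < x < 1] and [n > 0] the subtracted term is [(1 - x) x^n / (1 - x^n)], a Lambert term
    scaled so as to tend to [1 / n] when [x] tends to 1. *)
Definition lambert_gap x n := n%:R^-1 - x ^+ n / geom_sum x n.

(** With [P n] for [geom_sum x n], the Lambert terms at [n] and [n + 1] differ by
    [x^n / (P n * P (n + 1))], and AM-GM bounds this by [1 / (n (n + 1))]. Writing [x] as a square
    keeps the exponents in AM-GM integral. *)
Lemma lambert_gap_antitone y n : 0 < y -> y <= 1 -> (0 < n)%N ->
  0 <= lambert_gap (y ^+ 2) n.+1 <= lambert_gap (y ^+ 2) n.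
Proof.
move=> y0 y1; case: n => // n _; set x := y ^+ 2.
have x0 : 0 < x by rewrite exprn_gt0.
have P_gt0 k : 0 < geom_sum x k.+1.
  by rewrite geom_sumSr ltr_wpDl ?exprn_gt0 // sumr_ge0 // => i _; rewrite exprn_ge0 // ltW.
have P_ge k : k.+1%:R * y ^+ k <= geom_sum x k.+1 by rewrite geom_sum_sqr_ge // ltW.
have pow_le i j : (i <= j)%N -> y ^+ j <= y ^+ i by move=> ij; rewrite ler_wiXn2l // ltW.
rewrite /lambert_gap; apply/andP; split.
  rewrite subr_ge0 ler_pdivrMr // mulrC ler_pdivlMr ?ltr0n // mulrC.
  apply: le_trans (P_ge _); rewrite ler_wpM2l // -exprM; apply: pow_le; lia.
rewrite lerBlDr -addrA -lerBlDl -[leRHS]addrC.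
have -> : n.+2%:R^-1 - n.+1%:R^-1 = - (n.+1%:R * n.+2%:R)^-1 :> R.
  have -> : n.+2%:R = n.+1%:R + 1 :> R by rewrite natr1.
  have : 0 < n.+1%:R :> R by rewrite ltr0n.
  by move: n.+1%:R => m m0; field; apply/andP; split; lra.
rewrite lerNl opprB.
have -> : x ^+ n.+1 / geom_sum x n.+1 - x ^+ n.+2 / geom_sum x n.+2 =
   x ^+ n.+1 / (geom_sum x n.+1 * geom_sum x n.+2).
  have := P_gt0 n.+1; have := P_gt0 n; rewrite (geom_sumS x n.+1) => h1 h2.
  by rewrite [x ^+ n.+2]exprS; field; rewrite !gt_eqF.
rewrite ler_pdivrMr ?mulr_gt0 // mulrC ler_pdivlMr ?mulr_gt0 ?ltr0n //.
have ge0 k : 0 <= k.+1%:R * y ^+ k by rewrite mulr_ge0 ?exprn_ge0 // ltW.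
apply: le_trans (ler_pM (ge0 _) (ge0 _) (P_ge n) (P_ge n.+1)).
have -> : n.+1%:R * y ^+ n * (n.+2%:R * y ^+ n.+1) =
  y ^+ (n + n.+1) * (n.+1%:R * n.+2%:R) by rewrite exprD; ring.
rewrite ler_wpM2r ?mulr_ge0 // -exprM; apply: pow_le; lia.
Qed.

End GeometricSums.

(** * Divisor sums of a real character and their Lambert series *)

Section DivisorSum.
Variables (R : realType) (r : nat -> R).
Hypothesis r1 : r 1 = 1.
Hypothesis rM : forall m n, r (m * n) = r m * r n.
Hypothesis r_val : forall n, [\/ r n = 0, r n = 1 | r n = -1].

Definition divisor_sum n := \sum_(1 <= d < n.+1 | (d %| n)%N) r d.

(** The divisors prime to [p] are those of [m]; the others are [p * e] with [e] dividing
    [p ^ k * m]. *)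
Lemma divisor_sum_primeXS p k m : prime p -> (0 < m)%N -> ~~ (p %| m)%N ->
  divisor_sum (p ^ k.+1 * m) = divisor_sum m + r p * divisor_sum (p ^ k * m).
Proof.
move=> p_pr m_gt0 pNm; have p_gt0 := prime_gt0 p_pr.
set n := (p ^ k.+1 * m)%N; have n_gt0 : (0 < n)%N by rewrite muln_gt0 expn_gt0 p_gt0.
have nE : n = (p * (p ^ k * m))%N by rewrite mulnA -expnS.
rewrite /divisor_sum (bigID (fun d => p %| d)%N) /= addrC; congr (_ + _).
  rewrite [RHS](big_nat_widen _ _ n.+1) ?ltnS ?leq_pmull ?expn_gt0 ?p_gt0 //.
  rewrite big_nat_cond [RHS]big_nat_cond; apply: eq_bigl => d.
  apply: andb_id2l => /andP[d_gt0 _]; case: (boolP (d %| m)%N) => [dm|dNm] /=.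
    rewrite dvdn_mull //= ltnS dvdn_leq //.
    by apply: contra pNm => /dvdn_trans; apply.
  apply/negbTE; apply: contra dNm => /andP[dn pNd].
  by rewrite -(@Gauss_dvdr _ (p ^ k.+1)) // coprimeXr // coprime_sym prime_coprime.
rewrite (eq_bigl (fun d => (p %| d)%N && (d %| n)%N)); last by move=> d; rewrite andbC.
rewrite big_mkcondr sum_multiples // {1}nE mulKn // mulr_sumr [RHS]big_mkcond.
by apply: eq_bigr => e _; rewrite nE dvdn_pmul2l // rM.
Qed.

Lemma divisor_sum_primeX p k m : prime p -> (0 < m)%N -> ~~ (p %| m)%N ->
  exists c, [/\ divisor_sum (p ^ k * m) = c * divisor_sum m, 0 <= c &
                ~~ odd k -> 1 <= c].
Proof.
move=> p_pr m_gt0 pNm.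
(* Horner form of [1 + r p + ... + (r p) ^ k]: it is 1, [k + 1], or the indicator of even [k], as
   [r p] is 0, 1 or -1. *)
pose c := fix c k := if k is k'.+1 then 1 + r p * c k' else 1 : R.
have cE j : divisor_sum (p ^ j * m) = c j * divisor_sum m.
  elim: j => [|j IH]; first by rewrite mul1n mul1r.
  by rewrite divisor_sum_primeXS // IH /=; ring.
exists (c k); split => //; case: (r_val p) => rp.
- by case: k => [|k] //=; rewrite rp mul0r addr0.
- by elim: k => [|k IH] //=; rewrite rp mul1r addr_ge0.
- suff -> : c k = (~~ odd k)%:R by [].
  by elim: k => [//|k IH] /=; rewrite IH rp; case: (odd k) => /=; rewrite ?mulr0; lra.
- by case: k => [|k] //=; rewrite rp mul0r addr0.
- by move=> _; elim: k => [|k IH] //=; rewrite rp mul1r; lra.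
suff -> : c k = (~~ odd k)%:R by move=> ->.
by elim: k => [//|k IH] /=; rewrite IH rp; case: (odd k) => /=; rewrite ?mulr0; lra.
Qed.

Lemma divisor_sum1 : divisor_sum 1 = 1.
Proof. by rewrite /divisor_sum big_mkcond big_nat1. Qed.

Lemma partn_decomp n : (1 < n)%N ->
  exists p k m, [/\ prime p, (0 < m)%N, ~~ (p %| m)%N, n = (p ^ k * m)%N & (m < n)%N].
Proof.
move=> n_gt1; have n_gt0 : (0 < n)%N by rewrite ltnW.
have p_pr := pdiv_prime n_gt1; set p := pdiv n in p_pr.
have [m pm nE] := pfactor_coprime p_pr n_gt0.
have m_gt0 : (0 < m)%N by move: n_gt0; rewrite nE muln_gt0 => /andP[].
exists p, (logn p n), m; split => //; first by rewrite -prime_coprime.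
  by rewrite mulnC -nE.
rewrite [ltnRHS]nE -{1}(muln1 m) ltn_pmul2l // -(expn0 p) ltn_exp2l ?prime_gt1 //.
by rewrite logn_gt0 mem_primes p_pr n_gt0 pdiv_dvd.
Qed.

Lemma divisor_sum_ge0 n : (0 < n)%N -> 0 <= divisor_sum n.
Proof.
elim/ltn_ind: n => n IH n_gt0; have [n1|n_gt1] := leqP n 1.
  have -> : n = 1%N by apply/eqP; rewrite eqn_leq n1.
  by rewrite divisor_sum1.
have [p [k [m [p_pr m_gt0 pm nE mn]]]] := partn_decomp n_gt1.
have [c [E c0 _]] := divisor_sum_primeX k p_pr m_gt0 pm.
by rewrite nE E mulr_ge0 // IH.
Qed.

(** All exponents of a square are even, so every local factor is at least 1. *)
Lemma divisor_sum_square_ge1 n : (0 < n)%N -> 1 <= divisor_sum (n ^ 2).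
Proof.
elim/ltn_ind: n => n IH n_gt0; have [n1|n_gt1] := leqP n 1.
  have -> : n = 1%N by apply/eqP; rewrite eqn_leq n1.
  by rewrite divisor_sum1.
have [p [k [m [p_pr m_gt0 pm nE mn]]]] := partn_decomp n_gt1.
have := @divisor_sum_primeX p (k * 2) (m ^ 2) p_pr.
rewrite expn_gt0 m_gt0 Euclid_dvdX // (negbTE pm) => /(_ isT isT) [c [E c0 c1]].
rewrite nE expnMn -expnM E -[1]mulr1 ler_pM ?IH //.
by rewrite c1 // oddM andbF.
Qed.

Variable K B : R.
Hypothesis sum_r : forall m n, `|\sum_(m <= k < n) r k| <= K.
Hypothesis sum_r_div : forall N, `|\sum_(1 <= n < N.+1) r n / n%:R| <= B / N.+1%:R.

(** Real sequences are embedded as multiples of 1 to reuse [abel_bound]. *)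
Let abel_r (w : nat -> R) N :
  (forall n, (0 < n)%N -> 0 <= w n.+1 <= w n) ->
  `|\sum_(1 <= n < N.+1) w n * r n| <= K * w 1%N.
Proof.
move=> anti.
have norm_sum (f : nat -> R) a b :
    @Num.norm R (Rcomplex R) (\sum_(a <= n < b) f n *: 1) = `|\sum_(a <= n < b) f n|.
  by rewrite -scaler_suml Rcomplex_normZ Rcomplex_norm1 mulr1.
rewrite -norm_sum.
have -> : \sum_(1 <= n < N.+1) (w n * r n) *: (1 : Rcomplex R) =
          \sum_(1 <= n < N.+1) w n *: (r n *: (1 : Rcomplex R)).
  by apply: eq_bigr => n _; rewrite scalerA.
apply: abel_bound => //; first by move=> m n; rewrite norm_sum.
by have /andP[] := anti 1%N isT; exact: le_trans.
Qed.

(* Monsky's argument: [\sum_n r n * x ^ n / (1 - x ^ n)] is both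
   [\sum_n divisor_sum n * x ^ n] and, if [\sum_n r n / n = 0], bounded. *)
Lemma divisor_sum_lambert_le y N : 0 < y -> y < 1 ->
  (1 - y ^+ 2) * \sum_(1 <= n < N.+1) divisor_sum n * (y ^+ 2) ^+ n <=
  B / N.+1%:R + K * (1 - y ^+ 2) + N%:R * (y ^+ 2) ^+ N.
Proof.
move=> y0 y1; set x := y ^+ 2.
have x0 : 0 < x by rewrite exprn_gt0.
have x1 : x < 1 by rewrite exprn_ilt1 // ltW.
have P_gt0 k : (0 < k)%N -> 0 < geom_sum x k.
  case: k => // k _.
  by rewrite geom_sumSr ltr_wpDl ?exprn_gt0 // sumr_ge0 // => i _; rewrite exprn_ge0 // ltW.
have P_ge1 k : (0 < k)%N -> 1 <= geom_sum x k.
  case: k => // k _; rewrite geom_sumS lerDl; apply: mulr_ge0; first exact: ltW.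
  by rewrite sumr_ge0 // => i _; rewrite exprn_ge0 // ltW.
have -> : \sum_(1 <= n < N.+1) divisor_sum n * x ^+ n =
    \sum_(1 <= d < N.+1) \sum_(1 <= m < (N %/ d).+1) r d * x ^+ (d * m).
  rewrite (sum_divisors_exchange (fun d m => r d * x ^+ (d * m))).
  apply: eq_bigr => n _; rewrite mulr_suml big_nat_cond [RHS]big_nat_cond.
  by apply: eq_bigr => d /andP[_ dn]; rewrite mulnC divnK.
(* A finite geometric series in [x ^+ d], whose main term [x ^+ d / geom_sum x d] is [1 / d] minus
   the gap. *)
have inner d : (0 < d)%N -> (1 - x) * \sum_(1 <= m < (N %/ d).+1) r d * x ^+ (d * m) =
    r d / d%:R - lambert_gap x d * r d - r d * x ^+ (d * (N %/ d).+1) / geom_sum x d.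
  move=> d_gt0; rewrite -mulr_sumr.
  have P0 := P_gt0 d d_gt0; have d0 : d%:R != 0 :> R by rewrite pnatr_eq0 -lt0n.
  have H : geom_sum x d * ((1 - x) * \sum_(1 <= m < (N %/ d).+1) x ^+ (d * m)) =
      x ^+ d - x ^+ (d * (N %/ d).+1).
    rewrite mulrA [geom_sum x d * _]mulrC geom_sumE.
    elim: (N %/ d)%N => [|k IH]; first by rewrite big_geq // muln1 subrr mulr0.
    rewrite big_nat_recr //= mulrDr IH (mulnS d k.+1) exprD; ring.
  apply: (mulfI (lt0r_neq0 P0)); rewrite [(1 - x) * _]mulrCA [LHS]mulrCA H /lambert_gap.
  by field; rewrite d0 gt_eqF.
rewrite mulr_sumr (eq_big_nat _ _ (fun d hd => inner d (proj1 (andP hd)))).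
(* The first sum is small by [sum_r_div]; the second is bounded by Abel summation, as
   [lambert_gap x 1 = 1 - x]; each term of the third is at most [x ^+ N], since [d * (N %/ d).+1]
   exceeds [N]. *)
rewrite !sumrB; apply: lerD.
  apply: lerD.
    by apply: le_trans (sum_r_div N); exact: ler_norm.
  apply: le_trans (ler_norm _) _; rewrite normrN.
  apply: le_trans (@abel_r (lambert_gap x) N _) _.
    by move=> n n_gt0; apply: lambert_gap_antitone => //; exact: ltW.
  by rewrite /lambert_gap /geom_sum big_nat1 expr0 expr1 invr1 mulr1.
apply: le_trans (ler_norm _) _; rewrite normrN.
apply: le_trans (ler_norm_sum _ _ _) _; rewrite -sum_const_from1.
apply: ler_sum_nat => d /andP[d_gt0 _].
have rd1 : `|r d| <= 1 by case: (r_val d) => ->; rewrite ?normr0 ?normrN ?normr1.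
rewrite !normrM normfV (gtr0_norm (P_gt0 _ d_gt0)) ler_pdivrMr ?P_gt0 //.
rewrite (ger0_norm (exprn_ge0 _ (ltW x0))).
apply: (@le_trans _ _ (1 * x ^+ N)); last first.
  by rewrite mulrC ler_wpM2l ?exprn_ge0 ?P_ge1 // ltW.
apply: ler_pM => //; first by rewrite exprn_ge0 // ltW.
rewrite ler_wiXn2l // 1?ltW // ltnW // [in ltnLHS](divn_eq N d).
rewrite [(d * _)%N]mulnC mulSn addnC.
by rewrite ltn_add2r ltn_pmod.
Qed.

Lemma sum_div_not_vanishing : False.
Proof.
have B_ge0 : 0 <= B.
  by have := le_trans (normr_ge0 _) (sum_r_div 0); rewrite divr1.
have K_ge0 : 0 <= K := le_trans (normr_ge0 _) (sum_r 0 0).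
suff H j : (0 < j)%N -> j%:R / 2 <= B + K + 1 :> R.
  have := archi_boundP (_ : 0 <= 2 * (B + K + 1)).
  set j := Num.bound _; rewrite mulr_ge0 ?addr_ge0 // => /(_ isT).
  case: j (H j) => [_|j /(_ isT)]; lra.
(* With [y = 1 - 1 / M], each of the first [j] squares contributes at least 1/2 to the Lambert
   series. The cut-off [N = M ^ 3] makes the error terms at most [B / M] and [1 / M], and [1 / M] is
   at most [1 - x]. *)
move=> j_gt0; pose M := (4 * j ^ 2)%N.
have j1 : 1 <= j%:R :> R by rewrite ler1n.
have ME : M%:R = 4 * j%:R ^+ 2 :> R by rewrite natrM natrX.
have M4 : 4 <= M%:R :> R by rewrite ME; nra.
have M_gt0 : (0 < M)%N by rewrite muln_gt0 expn_gt0 j_gt0.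
pose y : R := 1 - M%:R^-1; pose N := (M ^ 3)%N.
have Minv0 : 0 < M%:R^-1 :> R by rewrite invr_gt0 ltr0n.
have Minv1 : M%:R^-1 <= 1 / 4 :> R.
  by rewrite ler_pdivlMr // mulrC ler_pdivrMr ?ltr0n // mul1r.
have y0 : 0 < y by rewrite /y; lra.
have y1 : y < 1 by rewrite /y; lra.
have gap : M%:R^-1 <= 1 - y ^+ 2 by rewrite /y; nra.
have := divisor_sum_lambert_le N y0 y1; set x := y ^+ 2 in gap *.
have x0 : 0 < x by rewrite exprn_gt0.
have x1 : x <= 1 by rewrite exprn_ile1 // ltW.
set D := \sum_(1 <= n < N.+1) _ => HD.
have bern n : (n <= M)%N -> 1 - n%:R / M%:R <= y ^+ n.
  elim: n => [|n IH] nM; first by rewrite mul0r subr0 expr0.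
  have := IH (ltnW nM) => /(ler_wpM2r (ltW y0)) H; rewrite exprSr; apply: le_trans H.
  rewrite /y -natr1; have : 0 <= n%:R / M%:R :> R by rewrite divr_ge0.
  have : 0 <= n%:R / M%:R * M%:R^-1 :> R by rewrite mulr_ge0 // ?divr_ge0 // invr_ge0.
  set u := n%:R / M%:R; rewrite mulrDl mul1r -/u; nra.
have D_ge : j%:R / 2 <= D.
  apply: (@le_trans _ _ (\sum_(1 <= i < j.+1) 1 / 2)).
    by rewrite sum_const_from1 mul1r.
  apply: (@le_trans _ _ (\sum_(1 <= i < j.+1) divisor_sum (i ^ 2) * x ^+ (i ^ 2))).
    apply: ler_sum_nat => i /andP[i_gt0 ij].
    rewrite -[1 / 2]mul1r; apply: ler_pM => //; first lra.
      exact: divisor_sum_square_ge1.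
    rewrite -exprM; apply: le_trans (bern _ _); last first.
      rewrite /M; rewrite ltnS in ij; have := leq_mul ij ij; rewrite !mulnn; lia.
    rewrite lerBrDl -lerBrDr ler_pdivrMr ?ltr0n // ME.
    have : (2 * i ^ 2)%N%:R <= (2 * j ^ 2)%N%:R :> R.
      by rewrite ler_nat leq_pmul2l // leq_exp2r.
    rewrite (natrM _ 2 (i ^ 2)) (natrM _ 2 (j ^ 2)) !natrX; lra.
  rewrite /D; pose F n := divisor_sum n * x ^+ n.
  have F0 n : (0 < n)%N -> 0 <= F n.
    by move=> n_gt0; rewrite mulr_ge0 ?divisor_sum_ge0 // exprn_ge0 // ltW.
  (* Only the square indices are kept, the other terms being nonnegative. *)
  suff H k : \sum_(1 <= i < k.+1) F (i ^ 2)%N <= \sum_(1 <= n < (k ^ 2).+1) F n.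
    apply: le_trans (H j) _.
    have jN : (j ^ 2 <= N)%N.
      rewrite /N /M; apply: (@leq_trans ((4 * j ^ 2) ^ 1)%N); first lia.
      by rewrite leq_pexp2l.
    rewrite [leRHS](@big_cat_nat _ _ _ (j ^ 2).+1) //= lerDl.
    rewrite big_nat_cond sumr_ge0 // => n /andP[/andP[jn _] _].
    by apply: F0; apply: leq_trans jn.
  elim: k => [|k IH]; first by rewrite !big_geq.
  rewrite big_nat_recr //= [leRHS](@big_cat_nat _ _ _ (k ^ 2).+1) //=; last first.
    by rewrite ltnS leq_exp2r.
  apply: lerD => //; rewrite -[X in index_iota _ X]/((k.+1 ^ 2).+1).
  rewrite big_nat_recr /=; last by rewrite ltn_exp2r.
  rewrite lerDr big_nat_cond sumr_ge0 // => n /andP[/andP[kn _] _].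
  by apply: F0; apply: leq_trans kn.
have N0 : 0 < N%:R :> R by rewrite ltr0n expn_gt0 M_gt0.
have M0 : 0 < M%:R :> R by rewrite ltr0n.
(* That is, [y ^+ n <= 1 / (1 + n / M)]. Squared at [n = N], this bounds [N * x ^+ N] by
   [M ^ 2 / N = 1 / M]. *)
have yN n : y ^+ n * (M%:R + n%:R) <= M%:R.
  elim: n => [|n IH]; first by rewrite expr0 mul1r addr0.
  apply: le_trans IH; rewrite exprSr -mulrA ler_wpM2l ?exprn_ge0 1?ltW //.
  have -> : y * (M%:R + n.+1%:R) = M%:R + n%:R - n%:R / M%:R - M%:R^-1.
    rewrite /y -natr1; field; lra.
  have : 0 <= n%:R / M%:R :> R by rewrite divr_ge0.
  lra.
have xN : N%:R * x ^+ N <= M%:R^-1.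
  have : y ^+ N * N%:R <= M%:R.
    apply: le_trans (yN N); apply: ler_wpM2l; first exact/exprn_ge0/ltW.
    by rewrite lerDr.
  have yN0 : 0 <= y ^+ N * N%:R by rewrite mulr_ge0 // exprn_ge0 // ltW.
  move=> H; have := ler_pM yN0 yN0 H H.
  have -> : y ^+ N * N%:R * (y ^+ N * N%:R) = N%:R * x ^+ N * N%:R.
    by rewrite /x -exprM mulnC exprM; ring.
  have -> : N%:R = M%:R ^+ 3 :> R by rewrite natrX.
  rewrite -ler_pdivlMr ?exprn_gt0 //; move/le_trans; apply.
  by rewrite le_eqVlt; apply/orP; left; apply/eqP; field; lra.
have BN : B / N.+1%:R <= B * M%:R^-1.
  rewrite ler_wpM2l // lef_pV2 ?posrE ?ltr0n // ler_nat leqW //.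
  by rewrite -{1}(expn1 M) leq_pexp2l.
have gap0 : 0 < 1 - x by exact: lt_le_trans gap.
apply: le_trans D_ge _; rewrite -(ler_pM2l gap0); apply: le_trans HD _.
have := ler_wpM2l B_ge0 gap; move: BN xN gap.
move: (B / N.+1%:R) (N%:R * x ^+ N) (M%:R^-1) (1 - x) => u v m g; lra.
Qed.

End DivisorSum.

(** * Dirichlet characters *)

(** ['X^n - 1] splits and is separable, so it has [n] distinct roots. *)
Lemma closed_prim_root_exists (F : closedFieldType) n :
  n%:R != 0 :> F -> exists z : F, n.-primitive_root z.
Proof.
move=> n_neq0; have n_gt0 : (0 < n)%N by case: n n_neq0 => //; rewrite eqxx.
have [r Dp] := closed_field_poly_normal ('X^n - 1 : {poly F}).
rewrite (monicP _) ?monicXnsubC // scale1r in Dp.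
have rn1 : all n.-unity_root r by apply/allP=> z; rewrite -root_prod_XsubC -Dp.
have sz_r : (n < (size r).+1)%N.
  by rewrite -(size_prod_XsubC r id) -Dp size_XnsubC.
have [|z] := hasP (has_prim_root n_gt0 rn1 _ sz_r); last by exists z.
by rewrite -separable_prod_XsubC -Dp separable_Xn_sub_1.
Qed.

Section DirichletCharacters.
Variables (R : realType) (q0 h0 : nat).
Local Notation C := (Rcomplex R).
Local Notation nrm := (@Num.norm R C).
Local Notation q := q0.+2.
Local Notation h := h0.+2.
Local Notation G := {unit 'Z_q}.
Hypothesis card_dvd : (#|[set: G]| %| h)%N.
Variable w : C.
Hypothesis w_prim : h.-primitive_root w.

(* Characters are represented by their logarithms to the base [w]. *)
Definition log_chars : {set {ffun G -> 'Z_h}} :=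
  [set f : {ffun G -> 'Z_h} | [forall x, forall y, f (x * y)%g == f x + f y]].

(** [insub] extends the character by 0 off the units. Moduli have the form [q0.+2] because ['Z_n] is
    the integers modulo 2 when [n < 2]. *)
Definition dchar (f : {ffun G -> 'Z_h}) (n : nat) : C :=
  if insub (n%:R : 'Z_q) is Some u then w ^+ f u else 0.

Implicit Types f g : {ffun G -> 'Z_h}.

Lemma log_charsP f : reflect {morph f : x y / (x * y)%g >-> x + y} (f \in log_chars).
Proof.
rewrite inE; apply: (iffP forallP) => [H x y|H x].
  by have /forallP/(_ y)/eqP := H x.
by apply/forallP => y; rewrite H.
Qed.

Lemma expr_Zp_add (i j : 'Z_h) : w ^+ (i + j)%R = w ^+ i * w ^+ j.
Proof. by rewrite -exprD -(prim_expr_mod w_prim (i + j)%N). Qed.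

Lemma log_char1 f : f \in log_chars -> f 1%g = 0.
Proof.
by move=> /log_charsP fM; apply: (addrI (f 1%g)); rewrite -fM mulg1 addr0.
Qed.

Lemma log_chars0 : 0 \in log_chars.
Proof. by apply/log_charsP => x y; rewrite !ffunE addr0. Qed.

Lemma log_charsD f g : f \in log_chars -> g \in log_chars -> f + g \in log_chars.
Proof.
move=> /log_charsP fM /log_charsP gM; apply/log_charsP => x y.
by rewrite !ffunE fM gM addrACA.
Qed.

Lemma log_charsN f : f \in log_chars -> - f \in log_chars.
Proof. by move=> /log_charsP fM; apply/log_charsP => x y; rewrite !ffunE fM opprD. Qed.

Lemma dchar_unit f n (u : G) : val u = n%:R -> dchar f n = w ^+ f u.
Proof. by move=> un; rewrite /dchar -un valK. Qed.

Lemma unit_of_coprime n : coprime q n -> exists u : G, val u = n%:R.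
Proof.
by rewrite -unitZpE // => U; exists (FinRing.unit _ U).
Qed.

Lemma dchar_nonunit f n : ~~ coprime q n -> dchar f n = 0.
Proof. by rewrite -unitZpE // => U; rewrite /dchar insubN. Qed.

Lemma dchar1 f : f \in log_chars -> dchar f 1 = 1.
Proof. by move=> fX; rewrite (@dchar_unit f 1 1%g) // log_char1. Qed.

Lemma dcharM f m n : f \in log_chars -> dchar f (m * n) = dchar f m * dchar f n.
Proof.
move=> fX.
have [/unit_of_coprime[u um]|mN] := boolP (coprime q m); last first.
  by rewrite !(@dchar_nonunit _ m) ?mul0r ?dchar_nonunit // coprimeMr (negbTE mN).
have [/unit_of_coprime[v vn]|nN] := boolP (coprime q n); last first.
  by rewrite !(@dchar_nonunit _ n) ?mulr0 ?dchar_nonunit // coprimeMr (negbTE nN) andbF.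
rewrite (dchar_unit _ um) (dchar_unit _ vn) -expr_Zp_add -(log_charsP _ fX).
by apply: dchar_unit; rewrite natrM -um -vn.
Qed.

Lemma dchar_mod f n : dchar f (n %% q) = dchar f n.
Proof. by rewrite /dchar Zp_nat_mod. Qed.

Lemma norm_w : nrm w = 1.
Proof.
apply/eqP; rewrite -(@pexpr_eq1 _ _ h) //.
have normX k : nrm (w ^+ k) = nrm w ^+ k.
  elim: k => [|k IH]; first by rewrite !expr0 Rcomplex_norm1.
  by rewrite !exprS Rcomplex_normM IH.
by rewrite -normX (prim_expr_order w_prim) Rcomplex_norm1.
Qed.

Lemma norm_wX k : nrm (w ^+ k) = 1.
Proof.
elim: k => [|k IH]; first by rewrite expr0 Rcomplex_norm1.
by rewrite exprS Rcomplex_normM IH norm_w mulr1.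
Qed.

Lemma norm_dchar_le1 f n : nrm (dchar f n) <= 1.
Proof.
have [/unit_of_coprime[u un]|nN] := boolP (coprime q n).
  by rewrite (dchar_unit _ un) norm_wX.
by rewrite dchar_nonunit // normr0.
Qed.

Lemma dchar0 n : dchar 0 n = (coprime q n)%:R.
Proof.
have [/unit_of_coprime[u un]|nN] := boolP (coprime q n).
  by rewrite (dchar_unit _ un) ffunE expr0.
by rewrite dchar_nonunit.
Qed.

Lemma dchar_log_eq1 f n (u : G) : val u = n%:R -> (dchar f n == 1) = (f u == 0).
Proof.
move=> un; rewrite (dchar_unit _ un) -(prim_order_dvd w_prim).
by rewrite /dvdn modn_small ?ltn_ord.
Qed.

(** Multiplying the residues by a unit [b] with value other than 1 permutes them, yet scales the sum
    by that value. *)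
Lemma sum_dchar_period f : f \in log_chars -> f != 0 ->
  \sum_(0 <= n < q) dchar f n = 0.
Proof.
move=> fX f_neq0.
have [u fu] : exists u, f u != 0.
  apply/existsP; rewrite -negb_forall; apply: contra f_neq0 => /forallP H.
  by apply/eqP/ffunP => u; rewrite ffunE; apply/eqP.
pose b : nat := val u; have ub : val u = b%:R by rewrite natr_Zp.
have b1 : dchar f b - 1 != 0 by rewrite subr_eq0 (dchar_log_eq1 _ ub).
apply: (mulfI b1); rewrite mulr0 mulrBl mul1r; apply/eqP; rewrite subr_eq0; apply/eqP.
rewrite big_mkord mulr_sumr [RHS](reindex_inj (h := fun x : 'Z_q => val u * x)) /=.
  apply: eq_bigr => x _; rewrite -dcharM // -dchar_mod; congr (dchar f _).
by apply: mulrI; exact: valP.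
Qed.

(** Full periods cancel, so an initial sum has norm at most [q]; a general range is a difference of
    two initial sums. *)
Lemma sum_dchar_le f m n : f \in log_chars -> f != 0 ->
  nrm (\sum_(m <= k < n) dchar f k) <= (2 * q)%:R.
Proof.
move=> fX f0.
have block k : \sum_(0 <= i < k * q) dchar f i = 0.
  elim: k => [|k IH]; first by rewrite big_geq.
  rewrite (@big_cat_nat _ _ _ (k * q)) ?leq_pmul2r //= IH add0r.
  rewrite -{1}(add0n (k * q)%N) big_addn mulSn addnK -[RHS](sum_dchar_period fX f0).
  by apply: eq_bigr => i _; rewrite -dchar_mod addnC modnMDl dchar_mod.
have initial k : nrm (\sum_(0 <= i < k) dchar f i) <= q%:R.
  rewrite (divn_eq k q) (@big_cat_nat _ _ _ (k %/ q * q)) ?leq_addr //= block add0r.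
  apply: le_trans (ler_norm_sum _ _ _) _.
  apply: le_trans (ler_sum _ (fun i _ => norm_dchar_le1 f i)) _.
  by rewrite sumr_const_nat addKn ler_nat ltnW // ltn_pmod.
have [mn|nm] := leqP m n; last by rewrite big_geq ?normr0 // ltnW.
have -> : \sum_(m <= k < n) dchar f k =
    \sum_(0 <= k < n) dchar f k - \sum_(0 <= k < m) dchar f k.
  by rewrite (@big_cat_nat _ _ _ m 0 n) //= addrAC subrr add0r.
apply: le_trans (ler_normB _ _) _; rewrite natrM mulr2n mulrDl mul1r.
exact: lerD.
Qed.

(** The irreducible characters of an abelian group are linear with trivial common kernel. Their
    values are [h]-th roots of unity in the algebraic numbers, whose exponents do not depend on the
    field and so can be used with [w]. *)
Lemma log_char_separates (u : G) : u != 1%g -> exists2 f, f \in log_chars & f u != 0.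
Proof.
move=> u_neq1.
have Gab : abelian [set: G] := units_Zp_abelian q.
have linG := char_abelianP _ Gab.
have [i ui] : exists i, u \notin cfker 'chi[[set: G]]_i.
  apply/existsP; rewrite -negb_forall; apply: contra u_neq1 => /forallP H.
  have := TI_cfker_irr [set: G]; move/setP/(_ u); rewrite inE => <-.
  by apply/bigcapP => i _; exact: H.
rewrite cfkerEirr inE lin_char1 // in ui.
have [z z_prim] := C_prim_root_exists (ltn0Sn h0.+1).
have rootE (x : G) : exists k : 'Z_h, 'chi_i x == z ^+ k.
  have /(prim_rootP z_prim)[k ->] : 'chi_i x ^+ h = 1.
    have /dvdnP[c hc] : (#[x]%g %| h)%N.
      by apply: dvdn_trans card_dvd; apply: order_dvdG; rewrite inE.
    by rewrite hc mulnC exprM lin_char_unity_root ?expr1n ?inE.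
  by exists k.
pose f : {ffun G -> 'Z_h} := [ffun x => xchoose (rootE x)].
have fE x : 'chi_i x = z ^+ f x by rewrite ffunE; apply/eqP/(xchooseP (rootE x)).
exists f; last first.
  by apply: contra ui => /eqP fu; rewrite fE fu expr0.
apply/log_charsP => x y; apply: val_inj => /=.
have : 'chi_i (x * y)%g == 'chi_i x * 'chi_i y by rewrite lin_charM ?inE.
rewrite !fE -exprD (eq_prim_root_expr z_prim) => /eqP E.
by rewrite -[LHS](@modn_small _ h) ?ltn_ord // E.
Qed.

(** Orthogonality: translating the characters by a [g] with value other than 1 at [n] scales the sum
    by that value. *)
Lemma sum_dchar_eq n : \sum_(f in log_chars) dchar f n =
  (n == 1 %[mod q])%:R * #|log_chars|%:R.
Proof.
have natE m : (m == 1 %[mod q])%N = (m%:R == 1 :> 'Z_q).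
  by rewrite -val_eqE /= val_Zp_nat.
have [/unit_of_coprime[u un]|nN] := boolP (coprime q n); last first.
  rewrite big1; last by move=> g _; rewrite dchar_nonunit.
  rewrite natE; case: eqP => [n1|_]; last by rewrite mul0r.
  by move: nN; rewrite -unitZpE // n1 unitr1.
rewrite natE -un; have [u1|u_neq1] := eqVneq (val u) 1.
  rewrite mul1r -sumr_const; apply: eq_bigr => g gX; apply/eqP.
  rewrite (dchar_log_eq1 _ un); have -> : u = 1%g by apply: val_inj.
  by rewrite log_char1.
rewrite mul0r; have [|g gX gu] := @log_char_separates u.
  by apply: contra u_neq1 => /eqP ->.
have g1 : dchar g n - 1 != 0 by rewrite subr_eq0 (dchar_log_eq1 _ un).
apply: (mulfI g1); rewrite mulr0 mulrBl mul1r; apply/eqP; rewrite subr_eq0; apply/eqP.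
rewrite mulr_sumr [RHS](reindex_inj (addrI g)) /=.
apply: eq_big => [k|k kX].
  apply/idP/idP => [kX|gkX]; first exact: log_charsD.
  by rewrite -(addKr g k) log_charsD // log_charsN.
by rewrite !(dchar_unit _ un) ffunE expr_Zp_add.
Qed.

(** The nonzero values have norm 1, so their inverses are their conjugates. *)
Lemma dcharN f n : f \in log_chars -> dchar (- f) n = conjc (dchar f n).
Proof.
move=> fX; have [/unit_of_coprime[u un]|nN] := boolP (coprime q n); last first.
  by rewrite !dchar_nonunit // (raddf0 (@conjc R)).
rewrite !(dchar_unit _ un).
have wu_neq0 : w ^+ f u != 0 by rewrite expf_neq0 // (prim_root_eq0 w_prim).
apply: (mulfI wu_neq0); rewrite -expr_Zp_add ffunE subrr expr0.
have := norm_wX (f u); case: (w ^+ f u) => a b; rewrite Rcomplex_normE => ab.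
have {}ab : a ^+ 2 + b ^+ 2 = 1.
  by rewrite -[LHS]sqr_sqrtr ?addr_ge0 ?sqr_ge0 // ab expr1n.
apply/eqP; rewrite eq_complex /= -ab; apply/andP; split; apply/eqP; ring.
Qed.

End DirichletCharacters.

(** * Dirichlet's theorem *)

Lemma ln_nat_unbounded (R : realType) (c : R) : exists2 N, (0 < N)%N & c < ln N%:R.
Proof.
exists (Num.bound (expR c)).
  by rewrite -(ltr0n R); apply: lt_trans (archi_boundP (expR_ge0 c)); exact: expR_gt0.
have H := archi_boundP (expR_ge0 c).
by rewrite -[ltLHS]expRK ltr_ln ?posrE ?expR_gt0 ?(lt_trans (expR_gt0 c) H).
Qed.

(** Nonprimes contribute at most 2. This serves both for a class supposed to have finitely many
    primes and for the integers not coprime to the modulus. *)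
Lemma sum_mangoldt_few_primes_le (R : realType) (P : pred nat) B N :
  (forall n, P n -> prime n -> (n <= B)%N) ->
  \sum_(1 <= n < N.+1 | P n) mangoldt R n / n%:R <=
  2 + \sum_(1 <= n < B.+1) mangoldt R n / n%:R.
Proof.
move=> PB; pose F n := mangoldt R n / n%:R.
have F_ge0 n : 0 <= F n by rewrite divr_ge0 ?mangoldt_ge0.
rewrite (bigID prime) /= addrC; apply: lerD.
  apply: le_trans (sum_mangoldt_nonprime_le R N).
  rewrite big_mkcond [leRHS]big_mkcond; apply: ler_sum => n _ /=.
  by case: (P n); case: (prime n) => //=; exact: F_ge0.
apply: (@le_trans _ _ (\sum_(1 <= n < (maxn N B).+1 | (n <= B)%N) F n)).
  apply: (@le_trans _ _ (\sum_(1 <= n < N.+1 | (n <= B)%N) F n)).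
    rewrite big_mkcond [leRHS]big_mkcond; apply: ler_sum => n _ /=.
    case: (boolP (P n)) => Pn /=; last by case: ifP => // _; exact: F_ge0.
    case: (boolP (prime n)) => pr_n /=; last by case: ifP => // _; exact: F_ge0.
    by rewrite PB.
  rewrite [leRHS](@big_cat_nat _ _ _ N.+1) //= ?ltnS ?leq_maxl // lerDl.
  by rewrite sumr_ge0 // => n _; exact: F_ge0.
rewrite le_eqVlt; apply/orP; left; apply/eqP.
by rewrite [RHS](big_nat_widen _ _ (maxn N B).+1) // ltnS leq_maxr.
Qed.

(** * Nonvanishing of the series, and primes in a residue class *)

Section NonVanishing.
Variables (R : realType) (q0 h0 : nat).
Local Notation C := (Rcomplex R).
Local Notation nrm := (@Num.norm R C).
Local Notation Re := (@complex.Re R).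
Local Notation q := q0.+2.
Local Notation h := h0.+2.
Local Notation G := {unit 'Z_q}.
Hypothesis card_dvd : (#|[set: G]| %| h)%N.
Variable w : C.
Hypothesis w_prim : h.-primitive_root w.
Local Notation X := (log_chars q0 h0).
Implicit Types f g : {ffun G -> 'Z_h}.

Definition char_sum f N : C :=
  \sum_(1 <= n < N.+1) (mangoldt R n / n%:R) *: dchar w f n.

Lemma Re_le_norm (x : C) : Re x <= nrm x.
Proof. exact: le_trans (ler_norm _) (le_Re_norm x). Qed.

Lemma Re_ge_norm (x : C) : - nrm x <= Re x.
Proof. by rewrite lerNl; apply: le_trans (le_Re_norm x); rewrite -normrN ler_norm. Qed.

Lemma Re_scale1 (a : R) : Re (a *: (1 : C)) = a.
Proof. by rewrite -[a *: _]/(Complex (a * 1) (a * 0)) /= mulr1. Qed.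

Lemma Re_scale (a : R) (x : C) : Re (a *: x) = a * Re x.
Proof. by case: x. Qed.

Lemma ReD (x y : C) : Re (x + y) = Re x + Re y.
Proof. exact: raddfD. Qed.

Lemma Re_sum (I : Type) (s : seq I) (P : pred I) (F : I -> C) :
  Re (\sum_(i <- s | P i) F i) = \sum_(i <- s | P i) Re (F i).
Proof. exact: raddf_sum. Qed.

Lemma char_sum_dichotomy f : f \in X -> f != 0 ->
  (exists B, forall N, (0 < N)%N -> nrm (char_sum f N) <= B) \/
  ((exists B, forall N, (0 < N)%N -> nrm (char_sum f N + ln N%:R *: 1) <= B) /\
   (exists B, forall N,
      nrm (\sum_(1 <= n < N.+1) (1 / n%:R) *: dchar w f n) <= B / N.+1%:R)).
Proof.
move=> fX f0; apply: (@twisted_mangoldt_dichotomy R (dchar w f) (2 * q)%N%:R).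
- exact: dchar1.
- by move=> m n; exact: dcharM.
- by move=> n; exact: norm_dchar_le1.
- by move=> m n; exact: sum_dchar_le.
Qed.

Lemma char_sum0E N :
  char_sum 0 N = (\sum_(1 <= n < N.+1 | coprime q n) mangoldt R n / n%:R) *: 1.
Proof.
rewrite big_mkcond scaler_suml; apply: eq_bigr => n _; rewrite dchar0.
by case: ifP => _; rewrite ?scaler0 ?scale0r.
Qed.

Lemma char_sum_twistE b N :
  \sum_(f in X) dchar w f b * char_sum f N =
  (#|X|%:R * \sum_(1 <= n < N.+1 | (b * n == 1 %[mod q])%N) mangoldt R n / n%:R) *: 1.
Proof.
under eq_bigr => f _ do rewrite mulr_sumr.
rewrite exchange_big /= mulr_sumr [in RHS]big_mkcond scaler_suml; apply: eq_bigr => n _.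
transitivity ((mangoldt R n / n%:R) *: \sum_(f in X) dchar w f (b * n)).
  by rewrite scaler_sumr; apply: eq_bigr => f fX; rewrite Rcomplex_scaleAr dcharM.
rewrite sum_dchar_eq //; case: ifP => _; last by rewrite mul0r scaler0 scale0r.
by rewrite mul1r -[in LHS](scaler_nat #|X|) scalerA mulrC.
Qed.

(** By [dcharN], [- f = f] says that the character is real, so its values are 0, 1 or -1. *)
Lemma real_dchar_not_vanishing f : f \in X -> f != 0 -> - f = f ->
  ~ exists B, forall N,
    nrm (\sum_(1 <= n < N.+1) (1 / n%:R) *: dchar w f n) <= B / N.+1%:R.
Proof.
move=> fX f0 fN [B HB]; pose r n : R := Re (dchar w f n).
have rE n : dchar w f n = r n *: 1.
  have := dcharN w_prim n fX; rewrite fN /r; case: (dchar w f n) => x y [].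
  move=> yE; have y0 : y = 0 by lra.
  by rewrite y0 -[_ *: _]/(Complex (x * 1) (x * 0)) mulr1 mulr0.
have normrE (x : R) : nrm (x *: 1) = `|x|.
  by rewrite Rcomplex_normZ Rcomplex_norm1 mulr1.
have scale_inj (x y : R) : x *: (1 : C) = y *: 1 -> x = y.
  by move=> /(congr1 Re); rewrite !Re_scale1.
apply: (@sum_div_not_vanishing R r _ _ _ (2 * q)%N%:R B).
- by rewrite /r dchar1.
- move=> m n; apply: scale_inj; rewrite -rE dcharM // !rE.
  by rewrite -scalerAl mul1r scalerA.
- move=> n; have [/unit_of_coprime[u un]|nN] := boolP (coprime q n); last first.
    by apply: Or31; rewrite /r dchar_nonunit.
  have : `|r n| = 1 by rewrite -normrE -rE (dchar_unit _ _ un) (norm_wX w_prim).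
  move/eqP; rewrite eqr_norml ler01 andbT => /orP[]/eqP ->; [exact: Or32|exact: Or33].
- move=> m n; rewrite -normrE scaler_suml; under eq_bigr => i _ do rewrite -rE.
  exact: sum_dchar_le.
- move=> N; apply: le_trans (HB N); rewrite -normrE scaler_suml.
  rewrite le_eqVlt; apply/orP; left; apply/eqP; congr nrm.
  by apply: eq_bigr => n _; rewrite rE scalerA mul1r mulrC.
Qed.

(* If the series of a non-real character vanished, so would that of its
   conjugate; the two of them would push the sum over all characters, which is
   nonnegative, below [3/2 * ln N - 2 * ln N + O(1)]. *)
Lemma char_sum_bounded f : f \in X -> f != 0 ->
  exists B, forall N, (0 < N)%N -> nrm (char_sum f N) <= B.
Proof.
move=> fX f0; have [//|[[B HB] vanish]] := char_sum_dichotomy fX f0.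
have [fN|fN] := eqVneq (- f) f; first by case: (real_dchar_not_vanishing fX f0 fN).
exfalso.
have lnN_ge0 N : (0 < N)%N -> 0 <= ln N%:R :> R by move=> ?; rewrite ln_ge0 // ler1n.
have Re_f N : (0 < N)%N -> Re (char_sum f N) <= B - ln N%:R.
  move=> N_gt0; have := le_trans (Re_le_norm _) (HB N N_gt0).
  by rewrite ReD Re_scale1 lerBrDr.
have Re_Nf N : Re (char_sum (- f) N) = Re (char_sum f N).
  rewrite /char_sum !Re_sum; apply: eq_bigr => n _.
  by rewrite !Re_scale dcharN //; case: (dchar w f n).
(* In either case of the dichotomy the real part is bounded above, as [- ln N] only lowers it. *)
have /choice[b Hb] g : exists b, g \in X -> g != 0 ->
    forall N, (0 < N)%N -> Re (char_sum g N) <= b.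
  have [gX|gX] := boolP (g \in X); last by exists 0.
  have [g0|g0] := eqVneq g 0; first by exists 0.
  have [[b Hb]|[[b Hb] _]] := char_sum_dichotomy gX g0; exists b => _ _ N N_gt0.
    exact: le_trans (Re_le_norm _) (Hb N N_gt0).
  have := le_trans (Re_le_norm _) (Hb N N_gt0).
  by rewrite ReD Re_scale1; have := lnN_ge0 N N_gt0; lra.
pose P g := [&& g \in X, g != 0, g != f & g != - f].
(* Chosen so that [ln N / 2], the excess of [2 * ln N] over [3 / 2 * ln N], exceeds all the
   constants. *)
have [N N_gt0] := @ln_nat_unbounded R
  (2 * (3 / 2 * ln 2 + 2 * B + \sum_(g | P g) b g)).
(* By orthogonality this is a sum of nonnegative terms over the class of 1. *)
have : 0 <= Re (\sum_(g in X) dchar w g 1 * char_sum g N).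
  rewrite char_sum_twistE Re_scale1 mulr_ge0 // sumr_ge0 // => n _.
  by rewrite divr_ge0 ?mangoldt_ge0.
under eq_bigr => g gX do rewrite dchar1 // mul1r.
rewrite Re_sum (bigD1 (0 : {ffun G -> 'Z_h})) ?log_chars0 //= (bigD1 f) ?fX ?f0 //=.
rewrite (bigD1 (- f)) /=; last by rewrite log_charsN // oppr_eq0 f0 fN.
rewrite Re_Nf; set S := \sum_(_ | _) complex.Re _.
have : S <= \sum_(g | P g) b g.
  rewrite /S (eq_bigl P); last by move=> g; rewrite /P -!andbA.
  by apply: ler_sum => g /and4P[gX g0 _ _]; exact: Hb.
have := Re_f N N_gt0.
have : Re (char_sum 0 N) <= 3 / 2 * (ln N%:R + ln 2).
  apply: le_trans (sum_mangoldt_div_le R N_gt0); rewrite char_sum0E Re_scale1.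
  rewrite big_mkcond; apply: ler_sum => n _; case: ifP => // _.
  by rewrite divr_ge0 ?mangoldt_ge0.
lra.
Qed.

Lemma primes_in_progression_unit a B : coprime q a ->
  exists p, [/\ prime p, (B < p)%N & p = a %[mod q]].
Proof.
move=> co_qa; apply: contrapT => noprime.
pose c : R := 2 + \sum_(1 <= n < B.+1) mangoldt R n / n%:R.
(* The primes not coprime to [q] divide it, so they are at most [q]. *)
pose c0 : R := 2 + \sum_(1 <= n < q.+1) mangoldt R n / n%:R.
(* With [b] inverse to [a], the condition [b * n = 1] selects the class of [a]. *)
pose b : nat := val ((a%:R : 'Z_q)^-1).
have unit_a : (a%:R : 'Z_q) \is a GRing.unit by rewrite unitZpE.
have bE : (b%:R : 'Z_q) = a%:R^-1 by rewrite natr_Zp.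
have co_qb : coprime q b by rewrite -unitZpE // bE unitrV.
have bn n : (b * n == 1 %[mod q])%N = (n == a %[mod q])%N.
  have natE m k : (m == k %[mod q])%N = (m%:R == k%:R :> 'Z_q).
    by rewrite -val_eqE /= !val_Zp_nat.
  by rewrite !natE natrM bE -(inj_eq (mulrI unit_a)) mulVKr // mulr1.
have /choice[e He] g : exists e, g \in X -> g != 0 ->
    forall N, (0 < N)%N -> nrm (char_sum g N) <= e.
  have [gX|gX] := boolP (g \in X); last by exists 0.
  have [g0|g0] := eqVneq g 0; first by exists 0.
  by have [e He] := char_sum_bounded gX g0; exists e => _ _.
(* The class contributes at most [#|X| * c], the principal character at least [ln N - 1 - c0], and
   any other [g] at least [- e g]. *)
have [N N_gt0] := @ln_nat_unbounded R
  (#|X|%:R * c + 1 + c0 + \sum_(g in X | g != 0) e g).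
have : Re (\sum_(g in X) dchar w g b * char_sum g N) <= #|X|%:R * c.
  rewrite char_sum_twistE Re_scale1 ler_wpM2l //.
  apply: sum_mangoldt_few_primes_le => p; rewrite bn => /eqP pa p_pr.
  by rewrite leqNgt; apply/negP => Bp; apply: noprime; exists p.
rewrite Re_sum (bigD1 (0 : {ffun G -> 'Z_h})) ?log_chars0 //= dchar0 co_qb mul1r.
have : ln N%:R - 1 - c0 <= Re (char_sum 0 N).
  rewrite char_sum0E Re_scale1; have := sum_mangoldt_div_ge R N_gt0.
  rewrite (bigID (fun n => coprime q n)) /=.
  have : \sum_(1 <= n < N.+1 | ~~ coprime q n) mangoldt R n / n%:R <= c0.
    apply: sum_mangoldt_few_primes_le => p; rewrite coprime_sym => pN p_pr.
    by rewrite dvdn_leq //; move: pN; rewrite prime_coprime // negbK.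
  lra.
have : - \sum_(g in X | g != 0) e g <=
    \sum_(g in X | g != 0) Re (dchar w g b * char_sum g N).
  rewrite -sumrN; apply: ler_sum => g /andP[gX g0].
  apply: le_trans (Re_ge_norm _); rewrite lerN2 Rcomplex_normM.
  apply: le_trans (He g gX g0 N N_gt0).
  by rewrite ler_piMl // norm_dchar_le1.
lra.
Qed.

End NonVanishing.

Theorem dirichlet_primes q a B : (0 < q)%N -> coprime q a ->
  exists p, [/\ prime p, (B < p)%N & p = a %[mod q]].
Proof.
case: q => [//|[|q0]] _ co_qa.
  have [p Bp p_pr] := prime_above B; exists p; split=> //.
  by rewrite !modn1.
(* The order [k] can be 1, so roots of unity of order [2 * k] are used to have [h] at least 2. *)
pose k := #|[set: {unit 'Z_q0.+2}]|.
have k_gt0 : (0 < k)%N by rewrite cardG_gt0.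
have hE : (k.*2.-2.+2 = k.*2)%N by case: (k) k_gt0.
have [w w_prim] : exists w : Rcomplex Rdefinitions.R, (k.*2.-2.+2).-primitive_root w.
  apply: (@closed_prim_root_exists (complex Rdefinitions.R)).
  by rewrite pnatr_eq0.
apply: (primes_in_progression_unit _ w_prim) => //.
by rewrite hE -muln2 dvdn_mulr.
Qed.

Local Close Scope ring_scope.

(** * Trees *)

(** Induction through the nested list; [foldr] is the conjunction of the hypotheses at all
    children. *)
Lemma planar_tree_nested_ind (P : planar_tree -> Prop) :
  (forall ts, foldr (fun t Q => P t /\ Q) True ts -> P (Node ts)) -> forall t, P t.
Proof.
move=> step; fix IH 1; case=> ts; apply: step.
by elim: ts => [|t ts IHts] /=; [|split; [exact: IH|exact: IHts]].
Qed.

Lemma primes_cons p e m : prime p -> 0 < e -> 0 < m ->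
  (forall r, r \in primes m -> p < r) -> primes (p ^ e * m) = p :: primes m.
Proof.
move=> p_pr e_gt0 m_gt0 lt_pm.
have p_gt0 := prime_gt0 p_pr.
apply: (irr_sorted_eq ltn_trans ltnn) => [||r]; first exact: sorted_primes.
  rewrite /= path_min_sorted ?sorted_primes //.
  exact/allP.
by rewrite primesM ?expn_gt0 ?p_gt0 // primesX // primes_prime // !inE.
Qed.

(** A prime below all those of [m] comes first in [primes] and changes no other exponent, so it adds
    a leftmost child. *)
Lemma tree_of_cons p e m ts : prime p -> 0 < e -> 0 < m ->
  (forall r, r \in primes m -> p < r) -> tree_of m = Node ts ->
  tree_of (p ^ e * m) = Node (tree_of e :: ts).
Proof.
move=> p_pr e_gt0 m_gt0 lt_pm; have p_gt0 := prime_gt0 p_pr.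
rewrite tree_ofE => -[<-]; rewrite [LHS]tree_ofE primes_cons //=; congr Node.
have log_lt r : r \in primes m -> logn r (p ^ e * m) = logn r m.
  move=> rm; rewrite lognM ?expn_gt0 ?p_gt0 // lognX logn_prime //.
  by rewrite gtn_eqF ?muln0 // lt_pm.
congr (_ :: _); last by apply/eq_in_map => r rm; rewrite log_lt.
rewrite lognM ?expn_gt0 ?p_gt0 // pfactorK // (lognE p m).
case: ifP => [/and3P[_ _ pm]|_]; last by rewrite addn0.
by have := lt_pm p; rewrite mem_primes p_pr m_gt0 pm ltnn => /(_ isT).
Qed.

Lemma exp_modn_1totient q p e : 0 < q -> coprime q p -> 0 < e ->
  e = 1 %[mod totient q] -> p ^ e = p %[mod q].
Proof.
move=> q_gt0 co_qp e_gt0 e1.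
have /dvdnP[k eE] : totient q %| e - 1 by rewrite -eqn_mod_dvd // e1.
have -> : e = (totient q * k).+1 by rewrite mulnC -eE subn1 prednK.
rewrite expnS expnM -modnMmr -modnXm Euler_exp_totient; last by rewrite coprime_sym.
by rewrite modnXm exp1n modnMmr muln1.
Qed.

(* The first prime lies in the class of [c], all others in the class of [1];
   the exponents do not disturb this, being [1] modulo [totient q]. *)
Lemma tree_of_progression_bounded q c B ts : 0 < q -> coprime q c ->
  foldr (fun t Q => (exists e, [/\ 0 < e, e = 1 %[mod totient q] & tree_of e = t]) /\ Q)
    True ts -> (ts = [::] -> c = 1 %[mod q]) ->
  exists n, [/\ 0 < n, n = c %[mod q], tree_of n = Node ts,
                forall r, r \in primes n -> B < r & ts <> [::] -> B < n].
Proof.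
move=> q_gt0; elim: ts c B => [|t ts IH] c B co_qc.
  (* With no children [n] must be 1, whence the condition on [c]. *)
  by move=> _ /(_ erefl) c1; exists 1; split.
move=> [[e [e_gt0 e1 eE]] Hts] _.
have [p [p_pr Bp pc]] := dirichlet_primes B q_gt0 co_qc.
have p_gt0 := prime_gt0 p_pr.
(* Taking [p] as the new bound makes the remaining primes larger than [p]. *)
have [m [m_gt0 m1 mE mp _]] := IH 1 p (coprimen1 q) Hts (fun=> erefl).
have co_qp : coprime q p by rewrite -coprime_modr pc coprime_modr.
exists (p ^ e * m); split.
- by rewrite muln_gt0 expn_gt0 p_gt0.
- by rewrite -modnMm (exp_modn_1totient q_gt0 co_qp) // pc m1 modnMm muln1.
- by rewrite -eE; exact: tree_of_cons.
- move=> r; rewrite primes_cons // inE => /orP[/eqP -> //|/mp].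
  exact: ltn_trans.
- move=> _; apply: leq_trans Bp _; rewrite -{1}(expn1 p) -[p ^ 1]muln1 leq_mul //.
  by rewrite leq_pexp2l.
Qed.

Lemma tree_of_1mod t q : 0 < q ->
  exists n, [/\ 0 < n, n = 1 %[mod q] & tree_of n = t].
Proof.
(* The modulus varies in the induction, since the exponents are needed modulo [totient q]. *)
elim/planar_tree_nested_ind: t q => ts Hts q q_gt0.
have [||n [n_gt0 n1 nE _ _]] := @tree_of_progression_bounded q 1 0 ts q_gt0 (coprimen1 q).
- elim: ts Hts => //= t ts IH [Ht Hts]; split; last exact: IH.
  by apply: Ht; rewrite totient_gt0.
- by [].
by exists n.
Qed.

Lemma unbounded_infinite (A : set nat) :
  (forall B, exists2 n, A n & B < n) -> infinite_set A.
Proof.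
move=> unb /finite_seqP[s As]; have [n An] := unb (\max_(i <- s) i).
have : n \in s by move: An; rewrite As.
move=> ns; rewrite ltnNge => /negP; apply.
by rewrite (big_rem _ ns) /= leq_maxl.
Qed.

Local Open Scope classical_set_scope.

Theorem theorem5 (t : planar_tree) (ht : 0 < num_edges t)
    (q : nat) (hq : 1 <= q) (a : int) (haq : coprimez a q%:Z) :
  infinite_set [set n : nat | [/\ 0 < n, (n%:Z = a %[mod q%:Z])%Z
                                & tree_of n = t]].
Proof.
apply: unbounded_infinite => B.
have q_neq0 : (q%:Z != 0)%R by rewrite eqz_nat -lt0n.
(* The least nonnegative residue of [a], as a natural number. *)
pose c := absz (a %% q%:Z)%Z.
have cE : (c%:Z)%R = (a %% q%:Z)%Z by rewrite gez0_abs // modz_ge0.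
have co_qc : coprime q c.
  rewrite coprime_sym; have : coprimez c%:Z q%:Z by rewrite cE /coprimez gcdz_modl.
  by [].
(* Having an edge, the tree has a child at the root, which makes [n] exceed [B]. *)
case: t ht => ts; case: ts => [//|u us] _.
have [||n [n_gt0 nc nE _ Bn]] :=
    @tree_of_progression_bounded q c B (u :: us) hq co_qc.
- elim: (u :: us) => //= t ts IH; split=> //.
  by apply: tree_of_1mod; rewrite totient_gt0.
- by [].
exists n; last exact: Bn.
split=> //; rewrite -[RHS]modz_mod -cE !modz_nat nc //.
Qed.
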